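(* For every $\theta\in(0,\frac12)$ there is $s_\theta>0$ such that the following holds. Let $(g_n)$ be a sequence of nonnegative integers with $\frac{g_n}{n}\to\theta$, and let $\mathbf{T}_{2n,g_n}$ be a uniformly random triangulation of genus $g_n$ with $2n$ faces. Then, with high probability, one of the maximal tentacles of $\mathbf{T}_{2n,g_n}$ contains the ladder tentacle $B_\ell$ for $\ell=\lfloor s_\theta\log(n)\rfloor$.
   Context: A map is a finite graph (loops and multiple edges allowed) embedded on a compact connected oriented surface so that the connected components of the complement of the graph, called faces, are topological disks, considered up to homeomorphism; equivalently, a connected oriented surface obtained by gluing finitely many polygons side by side. Its genus is the genus of the surface. Maps are rooted, i.e. equipped with a distinguished oriented edge. The degree of a face is the number of edge-sides incident to it. A triangulation is a rooted map all of whose faces have degree $3$. $\mathcal{T}(2n,g)$ is the (finite) set of triangulations of genus $g$ with $2n$ faces; it is nonempty if and only if $n\ge 2g-1$. $\mathbf{T}_{2n,g}$ denotes a uniform random element of $\mathcal{T}(2n,g)$ (so $\mathbf{T}_{2n,g_n}$ is well defined for $n$ large). An event holds with high probability if its probability tends to $1$ as $n\to+\infty$. Tentacles. Given an edge $e$ with endpoints $a,b$ (possibly $a=b$) and $k\ge1$, a $k$-insertion in $e$ consists in opening $e$ into a $2$-gon with vertices $a,b$, and triangulating this $2$-gon by a sequence of $k-1$ edges and $k$ paths of length $2$: the $k-1$ parallel edges joining $a$ to $b$ divide the $2$-gon into $k$ consecutive $2$-gons, and inside each of these a path $a - w_i - b$ of length $2$ through a new vertex $w_i$ divides it into two triangles.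 This creates $2k$ triangles; the $2k$ new edges $aw_i$, $w_ib$ are the ones in which a further insertion can be performed. A tentacle is a triangulation of a $2$-gon (or a single edge, with no face) that can be obtained recursively by repeated such insertions, starting from a given edge. A maximal tentacle in $\mathbf{T}_{2n,g_n}$ is a tentacle contained in $\mathbf{T}_{2n,g_n}$ that is maximal for inclusion; its boundary is a $2$-gon whose two vertices may coincide in $\mathbf{T}_{2n,g_n}$. A maximal tentacle may consist of a single edge of $\mathbf{T}_{2n,g_n}$, if that edge is not included in a larger tentacle. Ladder tentacle. For $\ell\ge1$, $B_\ell$ is the tentacle with $2\ell-2$ faces obtained from a single edge $v_0v_1$ by $\ell-1$ successive $1$-insertions: the $i$-th one ($1\le i\le\ell-1$) is performed in the edge $v_{i-1}v_i$ and creates the new vertex $v_{i+1}$, joined to $v_{i-1}$ and $v_i$. A tentacle contains $B_\ell$ if it has a sub-triangulation bounded by a $2$-gon that is a copy of $B_\ell$. *)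

(* Defs.v *)
From HB Require Import structures.
From mathcomp Require Import all_boot all_order all_algebra all_fingroup.
From mathcomp Require Import all_classical all_reals all_analysis.

Set Implicit Arguments.
Unset Strict Implicit.
Unset Printing Implicit Defensive.

Import Order.TTheory GRing.Theory Num.Theory.
Import numFieldNormedType.Exports.

Local Open Scope nat_scope.

(* Maps on oriented surfaces are encoded by their darts (oriented edges):
   [rev] reverses a dart, and [next] sends a dart to the one following it along
   the boundary of the face lying to its left.  Edges are the orbits of [rev],
   faces those of [next], and vertices those of [next \o rev], which sends a
   dart to another dart with the same origin. *)

Section Triangulations.

Variable n : nat.

(* 2n triangles have 6n sides, hence a triangulation with 2n faces has 6n darts;
   the fields are [rev], [next] and the root dart. *)
Definition labelled_map := ('S_(6 * n) * 'S_(6 * n) * 'I_(6 * n))%type.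

Implicit Type m : labelled_map.

Definition lrev m : 'S_(6 * n) := m.1.1.
Definition lnext m : 'S_(6 * n) := m.1.2.
Definition lroot m : 'I_(6 * n) := m.2.

Definition edges m := porbits (lrev m).
Definition faces m := porbits (lnext m).
(* Permutations compose from left to right: this is [lnext m \o lrev m]. *)
Definition vertices m := porbits (lrev m * lnext m)%g.

Definition connected_map m : bool :=
  [transitive <<[set lrev m; lnext m]>>%g, on [set: 'I_(6 * n)] | 'P].

(* Every edge consists of two darts, every face has degree 3, and the genus is
   given by Euler's formula V - E + F = 2 - 2g. *)
Definition is_triangulation (g : nat) m : bool :=
  [&& [forall A in edges m, #|A| == 2],
      [forall A in faces m, #|A| == 3],
      connected_map m &
      #|vertices m| + #|faces m| + 2 * g == #|edges m| + 2].

Definition rooted_iso m m' : bool :=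
  [exists s : 'S_(6 * n),
    [&& [forall x, s (lrev m x) == lrev m' (s x)],
        [forall x, s (lnext m x) == lnext m' (s x)] &
        s (lroot m) == lroot m']].

(* T(2n, g): rooted triangulations up to isomorphism, i.e. up to relabelling of
   the darts; its elements are the isomorphism classes. *)
Definition triangulations (g : nat) : {set {set labelled_map}} :=
  equivalence_partition rooted_iso [set m | is_triangulation g m].

End Triangulations.

(* A planar map with a distinguished outer face, the one incident to [broot].
   [bfree] is the set of darts of the edges in which an insertion may still be
   performed. *)
Record bigon := Bigon {
  bdart :> finType;
  brev : bdart -> bdart;
  bnext : bdart -> bdart;
  broot : bdart;
  bfree : {set bdart} }.

Definition outer_darts (B : bigon) : {set B} :=
  [set x | fconnect (@bnext B) (broot B) x].

Definition inner_darts (B : bigon) : {set B} := ~: outer_darts B.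

(* A single edge, seen as a planar map: it has no face except the outer one,
   which has degree 2. *)
Definition single_edge : bigon := @Bigon bool negb negb true [set: bool].

(* The (k+1)-insertion in the edge {d, brev d}, where d goes from a to b.  The
   darts of B keep their left faces.  The edge is opened into a 2-gon bounded by
   the parallel edges e_0 (whose side b -> a outside the 2-gon is [brev d]) and
   e_(k+1) (whose side a -> b outside the 2-gon is [d]); e_1, ..., e_k are the
   intermediate ones.  For i <= k, the 2-gon between e_i and e_(i+1) is divided
   by the path a - w_i - b into two triangles, with sides
     (i, false, 0) : a -> b, on e_i        (i, true, 0) : b -> a, on e_(i+1)
     (i, false, 1) : b -> w_i              (i, true, 1) : a -> w_i
     (i, false, 2) : w_i -> a              (i, true, 2) : w_i -> b. *)
Section Insertion.

Variables (B : bigon) (d : B) (k : nat).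

Definition insertion_dart := (B + 'I_k.+1 * bool * 'Z_3)%type.

Definition insertion_rev (x : insertion_dart) : insertion_dart :=
  match x with
  | inl y => if y == d then inr (ord_max, true, 0%R)
             else if y == brev d then inr (ord0, false, 0%R)
             else inl (brev y)
  | inr (i, s, j) =>
      if j != 0%R then inr (i, ~~ s, (- j)%R)
      else if s then
        if i == ord_max then inl d else inr (ordS i, false, 0%R)
      else
        if i == ord0 then inl (brev d) else inr (ord_pred i, true, 0%R)
  end.

Definition insertion_next (x : insertion_dart) : insertion_dart :=
  match x with
  | inl y => inl (bnext y)
  | inr (i, s, j) => inr (i, s, (j + 1)%R)
  end.

Definition insertion_free : {set insertion_dart} :=
  [set x | match x with
           | inl y => y \in bfree B :\: [set d; brev d]
           | inr (_, _, j) => j != 0%R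
           end].

Definition insertion : bigon :=
  @Bigon insertion_dart insertion_rev insertion_next (inl (broot B))
    insertion_free.

End Insertion.

Inductive tentacle : bigon -> Prop :=
| tentacle_edge : tentacle single_edge
| tentacle_insertion (B : bigon) (d : B) (k : nat) :
    tentacle B -> d \in bfree B -> tentacle (insertion d k).

(* B_(i+1), together with the dart from v_i to v_(i+1). *)
Fixpoint ladder_rec (i : nat) : {B : bigon & B} :=
  if i is j.+1 then
    let: existT B d := ladder_rec j in
    existT (fun B : bigon => B) (insertion d 0) (inr (ord0, false, 1%R))
  else existT (fun B : bigon => B) single_edge true.

(* B_l, for l >= 1 (the value at l = 0 is irrelevant). *)
Definition ladder (l : nat) : bigon := projT1 (ladder_rec l.-1).

(* A copy of B inside the map (D, rev, next): the edges of B are sent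
   injectively to edges and its inner faces to faces.  The outer face is not
   constrained, so that the two boundary vertices may be identified, whereas
   inner vertices are kept distinct from all the others since all the darts
   around them belong to inner faces. *)
Definition embedding (B : bigon) (D : finType) (rev next : D -> D)
    (f : B -> D) : Prop :=
  [/\ injective f,
      forall x : B, f (brev x) = rev (f x) &
      forall x : B, x \in inner_darts B -> f (bnext x) = next (f x)].

(* The darts of the edges, and the darts of the inner faces, of a copy of B. *)
Definition edge_darts (B : bigon) (D : finType) (f : B -> D) : {set D} :=
  [set f x | x : B].
Definition face_darts (B : bigon) (D : finType) (f : B -> D) : {set D} :=
  [set f x | x in inner_darts B].

Definition sub_copy (D : finType) (B B' : bigon)
    (f : B -> D) (f' : B' -> D) : Prop :=
  edge_darts f \subset edge_darts f' /\ face_darts f \subset face_darts f'.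

Definition maximal_tentacle (D : finType) (rev next : D -> D)
    (B : bigon) (f : B -> D) : Prop :=
  [/\ tentacle B, embedding rev next f &
      forall (B' : bigon) (f' : B' -> D),
        tentacle B' -> embedding rev next f' -> sub_copy f f' ->
        sub_copy f' f].

Definition contains_ladder (l : nat) (B : bigon) : Prop :=
  exists h : ladder l -> B, embedding (@brev B) (@bnext B) h.

Definition has_maximal_tentacle_with_ladder (l n : nat)
    (m : labelled_map n) : Prop :=
  exists (B : bigon) (f : B -> 'I_(6 * n)),
    maximal_tentacle (lrev m) (lnext m) f /\ contains_ladder l B.

(* Probability that a uniform random element of T(2n, g) satisfies P, where P is
   a property of labelled maps invariant under isomorphism. *)
Definition triangulation_prob (R : realType) (n g : nat)
    (P : labelled_map n -> Prop) : R :=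
  (#|[set c in triangulations n g | `[< exists2 m, m \in c & P m >]]|%:R
   / #|triangulations n g|%:R)%R.

(* Main.v *)
(* Keep the 2n triangles fixed and vary only the gluing [rev] of their sides.
   There are n + 2 - 2g >= c n vertices, hence linearly many vertices of degree
   at most some constant.  Contracting an edge at such a vertex frees two
   triangles, which can be reinserted as one more rung of a ladder; to undo this
   one has to remember one edge and a bounded number of rotation steps around
   the merged vertex.  Thus extending a marked ladder by one rung loses at most a
   constant factor Q in the number of marked triangulations, as there are >= c n
   ways to do it and <= C n ways to undo it.  Start from the triangulations
   without the ladder of size l, with any of the 6n darts as a mark, and add
   l - 1 rungs.  Only O(l) darts have been reglued in the resulting
   triangulations, so that each of their ladders of size l passes through one of
   these darts and there are only O(l^2) of them.  Hence the proportion of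
   triangulations without the ladder is O(l^2 Q^l / n), which tends to 0 if
   l <= s log n with s small. *)

(* Every step of the surgery is a [switch], replacing two edges {a, r a}, {b, r b} by {a, b}, {r a,
   r b}. Darts and faces stay in place, and the vertex permutation [r * nx] is multiplied by two
   transpositions, so the genus is controlled by counting which cycles merge and which split. To
   keep the same darts, an edge is contracted by folding one of its triangles ([zip]); its two
   triangles are then cut out as a separate sphere ([excise]) and glued into the marked edge
   ([graft]). The vertex count does not see connectedness, which is followed separately. A loop
   cannot be contracted, nor an edge with the same triangle on both sides. This shapes the choice of
   the edge: a vertex of small degree that is not the only vertex has an edge leading elsewhere,
   which is suitable unless its triangle is folded around a vertex of degree 1. Such a triangle
   already looks like the result of a [zip] and is moved without contraction. *)
Require Import Defs.
From mathcomp Require Import all_boot all_order all_algebra all_fingroup.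
From mathcomp Require Import boolp.
From mathcomp Require Import zify.

Set Implicit Arguments.
Unset Strict Implicit.
Unset Printing Implicit Defensive.

Local Open Scope nat_scope.

(** * Switching two edges of a gluing *)

(* Stated over [Finite.sort D], so that [congruence] sees a single carrier. *)
Lemma neq_ft (D : finType) (x y : D) : x <> y -> x != y.
Proof. by move/eqP. Qed.

Lemma neqF_ft (D : finType) (x y : D) : x <> y -> (x == y) = false.
Proof. by move/eqP/negbTE. Qed.

Lemma dec_ft (D : finType) (x y : D) : x = y \/ x <> y.
Proof. by case: (eqVneq x y) => [|/eqP]; [left | right]. Qed.

Local Ltac neq := apply: neq_ft; congruence.

Section PermInvariance.
Variables (D : finType).
Implicit Types (p q : {perm D}) (S : pred D).

Definition invariant_under p S := forall z, S (p z) = S z.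

(** The inverse of a permutation of a finite set is one of its powers, so stability in one direction
    gives both. *)
Lemma stable_invariant p S : (forall z, S z -> S (p z)) -> invariant_under p S.
Proof.
move=> hS z; apply/idP/idP => [hz|]; last exact: hS.
have h i : S ((p ^+ i)%g (p z)).
  by elim: i => [|i IH]; rewrite ?expg0 ?perm1 // expgSr permM; apply: hS.
have := h #|porbit p z|.-1.
rewrite -permM -expgS prednK; last by rewrite lt0n card_porbit_neq0.
by rewrite permX iter_porbit.
Qed.

Lemma porbit_invariant p S x y :
  invariant_under p S -> x \in porbit p y -> S x = S y.
Proof.
move=> hS /porbitP[i ->]; elim: i => [|i IH]; first by rewrite expg0 perm1.
by rewrite expgSr permM hS.
Qed.

Lemma porbit_step p x y : p x = y -> y \in porbit p x.
Proof. by move<-; have := mem_porbit p 1 x; rewrite expg1. Qed.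

Lemma porbit_trans p x y z :
  x \in porbit p y -> y \in porbit p z -> x \in porbit p z.
Proof. by rewrite -!eq_porbit_mem => /eqP -> /eqP ->. Qed.

Lemma porbits_tperm_merge p x y : x \notin porbit p y ->
  #|porbits (tperm x y * p)|.+1 = #|porbits p|.
Proof.
move=> hxy; have := porbits_mul_tperm p x y; rewrite /= hxy.
have -> : x != y by apply: contraNN hxy => /eqP ->; apply: porbit_id.
by rewrite doubleS addnS addnS addn1 addn0 => -[].
Qed.

Lemma porbits_tperm_split p x y : x <> y -> x \in porbit p y ->
  #|porbits (tperm x y * p)| = #|porbits p|.+1.
Proof.
move=> /eqP nxy hxy; have := porbits_mul_tperm p x y.
by rewrite /= hxy nxy addn0 addn1.
Qed.

End PermInvariance.

Section Switch.
Variables (D : finType).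
Implicit Types (r nx : {perm D}) (S : pred D).

Definition matching r := (forall x, r (r x) = x) /\ (forall x, r x <> x).

(* The matching {a, r a}, {b, r b} is replaced by {a, b}, {r a, r b}. *)
Definition switch r a b : {perm D} :=
  (tperm (r a) b * tperm a (r b) * r)%g.

Variables (r : {perm D}) (a b : D).
Hypotheses (rM : matching r) (neq_ab : a <> b).

Let rK z : r (r z) = z. Proof. by case: rM. Qed.
Let rN z : r z <> z. Proof. by case: rM => _ /(_ z). Qed.

Lemma switchE z : switch r a b z =
  if z == a then b else if z == b then a else
  if z == r a then r b else if z == r b then r a else r z.
Proof.
have Na := @rN a; have Nb := @rN b; have Ka := rK a; have Kb := rK b.
have tD (x y t : D) : t <> x -> t <> y -> tperm x y t = t.
  by move=> tx ty; rewrite tpermD //; neq.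
rewrite /switch !permM.
case: (dec_ft z a) => [->|za]; first by rewrite eqxx [tperm (r a) _ _]tD ?tpermL ?rK //; congruence.
rewrite (neqF_ft za).
case: (dec_ft z b) => [->|zb].
  by rewrite eqxx tpermR tD ?rK //; congruence.
rewrite (neqF_ft zb).
case: (dec_ft z (r a)) => [->|zra]; first by rewrite eqxx tpermL tD //; congruence.
rewrite (neqF_ft zra) [tperm (r a) _ _]tD //.
case: (dec_ft z (r b)) => [->|zrb]; first by rewrite eqxx tpermR.
by rewrite (neqF_ft zrb) tD.
Qed.

Lemma switch_l : switch r a b a = b.
Proof. by rewrite switchE eqxx. Qed.

Lemma switch_r : switch r a b b = a.
Proof. by rewrite switchE eqxx neqF_ft //; congruence. Qed.

Lemma switch_revl : switch r a b (r a) = r b.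
Proof.
rewrite switchE eqxx (neqF_ft (@rN a)).
case: (dec_ft (r a) b) => [e|e]; first by rewrite e eqxx -e rK.
by rewrite (neqF_ft e).
Qed.

Lemma switch_revr : switch r a b (r b) = r a.
Proof.
rewrite switchE eqxx (neqF_ft (@rN b)).
case: (dec_ft (r b) a) => [e|e]; first by rewrite e eqxx -e rK.
rewrite (neqF_ft e); case: (dec_ft (r b) (r a)) => [/perm_inj h|h]; first by congruence.
by rewrite (neqF_ft h).
Qed.

Lemma switch_id z : z <> a -> z <> b -> r z <> a -> r z <> b ->
  switch r a b z = r z.
Proof.
move=> za zb rza rzb; have kz := rK z; have ka := rK a; have kb := rK b.
by rewrite switchE !neqF_ft //; congruence.
Qed.

Variant switch_spec z : D -> Prop :=
| SwitchL of z = a : switch_spec z b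
| SwitchR of z = b : switch_spec z a
| SwitchRevL of z = r a : switch_spec z (r b)
| SwitchRevR of z = r b : switch_spec z (r a)
| SwitchId of z <> a & z <> b & r z <> a & r z <> b : switch_spec z (r z).

Lemma switchP z : switch_spec z (switch r a b z).
Proof.
case: (dec_ft z a) => [->|za]; first by rewrite switch_l; constructor.
case: (dec_ft z b) => [->|zb]; first by rewrite switch_r; constructor.
case: (dec_ft z (r a)) => [->|zra]; first by rewrite switch_revl; constructor.
case: (dec_ft z (r b)) => [->|zrb]; first by rewrite switch_revr; constructor.
have kz := rK z.
by rewrite switch_id; [constructor| | | |]; congruence.
Qed.

Lemma switch_matching : matching (switch r a b).
Proof.
split=> z; last first.
  have ka := rK a; have kb := rK b; have na := @rN a; have nb := @rN b.
  by case: switchP (@rN z); congruence.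
case: (switchP z) => [->|->|->|->|za zb rza rzb].
- exact: switch_r.
- exact: switch_l.
- exact: switch_revr.
- exact: switch_revl.
- by rewrite switch_id ?rK.
Qed.

(** Carries connectedness through a switch: a union of components of the new map is one of the old
    map as soon as it separates neither of the two removed edges. *)
Lemma switch_invariant (S : pred D) : invariant_under (switch r a b) S ->
  S (r a) = S a -> S (r b) = S b -> invariant_under r S.
Proof.
move=> hS ha hb z; have := hS z.
case: switchP => [->|->|->|->|//]; by rewrite ?rK ?ha ?hb.
Qed.

End Switch.

(** The former partner of [a] is all that must be remembered to undo a switch. *)
Lemma switchK (D : finType) (r : {perm D}) a b : matching r -> a <> b ->
  switch (switch r a b) a (r a) = r.
Proof.
move=> rM ab; have sM := switch_matching rM ab.
have ka := rM.1 a; have kb := rM.1 b; have na := rM.2 a.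
apply/permP => z; case: switchP => //.
- congruence.
- by move=> ->.
- by move=> ->; rewrite ka.
- rewrite (switch_l rM ab) (switch_revl rM ab) => ->//.
- by rewrite (switch_revl rM ab) (switch_l rM ab) => ->.
move=> za zra; case: (switchP rM ab z) => //; congruence.
Qed.

Lemma card_switch_neq (D : finType) (r : {perm D}) a b :
  matching r -> a <> b -> #|[set z | switch r a b z != r z]| <= 4.
Proof.
move=> rM ab.
apply: (@leq_trans #|[:: a; b; r a; r b]|); last exact: card_size.
apply/subset_leq_card/fintype.subsetP => z; rewrite !inE.
by case: (switchP rM ab z) => [->|->|->|->|_ _ _ _]; rewrite eqxx ?orbT.
Qed.

Lemma switch_porbits (D : finType) (r nx : {perm D}) a b :
  (switch r a b * nx = tperm (r a) b * (tperm a (r b) * (r * nx)))%g.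
Proof. by rewrite /switch !mulgA. Qed.

(* Both transpositions in [switch_porbits] merge two cycles. *)
Lemma switch_porbits_merge (D : finType) (r nx : {perm D}) a b (K1 K2 : pred D) :
  invariant_under (r * nx)%g K1 -> invariant_under (r * nx)%g K2 ->
  K1 (r b) -> ~~ K1 a -> K2 b -> ~~ K2 (r a) -> ~~ K2 a -> ~~ K2 (r b) ->
  #|porbits (switch r a b * nx)| + 2 = #|porbits (r * nx)|.
Proof.
move=> h1 h2 k1 nk1 k2 nk2 nk2a nk2b; rewrite switch_porbits.
rewrite -(@porbits_tperm_merge _ (r * nx)%g a (r b)); last first.
  by apply: contraL k1 => /(porbit_invariant h1) <-.
rewrite addn2; congr _.+1; apply: porbits_tperm_merge.
have h : invariant_under (tperm a (r b) * (r * nx))%g K2.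
  move=> z; rewrite permM h2; case: tpermP => // ->.
    by rewrite (negbTE nk2a) (negbTE nk2b).
  by rewrite (negbTE nk2a) (negbTE nk2b).
by apply: contraL k2 => /(porbit_invariant h) <-.
Qed.

(** * Contracting an edge and reinserting two triangles *)

Definition triangular (D : finType) (nx : {perm D}) :=
  (forall z, nx (nx (nx z)) = z) /\ (forall z, nx z <> z).

(** Connectedness as the absence of a proper invariant set: no paths are needed, and
    [switch_invariant] applies directly. *)
Definition joined (D : finType) (r nx : {perm D}) := forall S : pred D,
  invariant_under r S -> invariant_under nx S -> forall u v, S u = S v.

Definition same_face (D : finType) (nx : {perm D}) (d z : D) :=
  [|| z == d, z == nx d | z == nx (nx d)].

Lemma same_face_next (D : finType) (nx : {perm D}) d z : triangular nx ->
  same_face nx d (nx z) = same_face nx d z.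
Proof.
move=> [n3 _]; rewrite /same_face.
rewrite -[X in nx z == X](n3 d) !(inj_eq perm_inj) orbC -orbA.
by congr orb; rewrite orbC.
Qed.

Section Surgery.

Variables (D : finType) (nx : {perm D}).
Hypothesis nxT : triangular nx.

Let n3 z : nx (nx (nx z)) = z. Proof. by case: nxT. Qed.
Let nN z : nx z <> z. Proof. by case: nxT => _ /(_ z). Qed.

(* Gluing together the two other sides of the face of [d]: up to the gluing of
   a face of degree 2, this contracts the edge of [d]. *)
Definition zip r d : {perm D} := switch r (nx d) (nx (nx d)).

(* When [d] is zipped, does the same in the face of [m d], which cuts out a
   sphere made of these two faces, glued along two sides as in an insertion. *)
Definition excise m d : {perm D} :=
  switch (switch m (nx d) (nx (nx (m d)))) (nx (nx d)) (nx (m d)).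

(** Used when [d] and [q d] are the two sides of an edge of the detached sphere: opening this edge
    and the edge of [x] and gluing them crosswise is a 1-insertion in the edge of [x]. *)
Definition graft q x d : {perm D} := switch q x d.

Definition transplant r d x := graft (excise (zip r d) d) x d.

Definition two_faces (r : {perm D}) d : pred D :=
  fun z => same_face nx d z || same_face nx (r d) z.

(** * Folding a triangle *)

Section Zip.

Variables (r : {perm D}) (d : D).
Hypotheses (rM : matching r) (faceN : ~~ same_face nx d (r d)).

Local Notation nd := (nx d).
Local Notation pd := (nx (nx d)).
Local Notation d' := (r d).
Local Notation nd' := (nx (r d)).
Local Notation pd' := (nx (nx (r d))).
Local Notation phi := (r * nx)%g.
Local Notation mid := (zip r d).

Let rK z : r (r z) = z. Proof. by case: rM. Qed.
Let rN z : r z <> z. Proof. by case: rM => _ /(_ z). Qed.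
Let k3 : nx pd = d. Proof. exact: n3. Qed.
Let k3' : nx pd' = d'. Proof. exact: n3. Qed.
Let ndd : nd <> d. Proof. exact: nN. Qed.
Let ndd' : nd' <> d'. Proof. exact: nN. Qed.
Let f1 : d' <> d. Proof. exact: rN. Qed.
Let f2 : d' <> nd. Proof. by move: faceN => /norP[_ /norP[/eqP]]. Qed.
Let f3 : d' <> pd. Proof. by move: faceN => /norP[_ /norP[_ /eqP]]. Qed.
Let rr : r d' = d. Proof. exact: rK. Qed.
Let nd_pd : nd <> pd. Proof. by move=> /esym; apply: nN. Qed.

Lemma zip_matching : matching mid.
Proof. exact: switch_matching. Qed.

Lemma zip_edge : mid d = d'.
Proof. by rewrite /zip switch_id //; congruence. Qed.

Lemma zip_zipped : mid nd = pd.
Proof. exact: switch_l. Qed.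

Lemma zip_id z : z <> nd -> z <> pd -> r z <> nd -> r z <> pd -> mid z = r z.
Proof. exact: switch_id. Qed.

Lemma zip_trivial : r nd = pd -> mid = r.
Proof.
move=> e; rewrite /zip /switch e !tperm1 -e rK.
by rewrite tperm1 !mul1g.
Qed.

Section DistinctEnds.
Hypothesis endsN : d' \notin porbit phi d.

Let phi_d' : phi d' = nd. Proof. by rewrite permM rr. Qed.
Let phi_d : phi d = nd'. Proof. by rewrite permM. Qed.

Let nd_cyc : nd \notin porbit phi d.
Proof.
apply: contra endsN; apply: porbit_trans.
by rewrite porbit_sym; apply: porbit_step.
Qed.

Let A_pd : r nd <> pd.
Proof.
move=> e; move: nd_cyc; rewrite porbit_sym.
by rewrite porbit_step // permM e n3.
Qed.

Let B_nd : r pd <> nd. Proof. by move=> e; apply: A_pd; have := rK pd; rewrite e. Qed.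

(* [mid * nx] runs through the cycle of [d] as [r * nx] does, skipping [pd]. *)
Let zip_reach i z : (phi ^+ i)%g z = r pd -> z \in porbit phi d -> z <> pd ->
  exists2 j, j <= i & ((mid * nx) ^+ j)%g z = r pd.
Proof.
elim/ltn_ind: i z => -[|i] IH z hi zd zpd.
  by exists 0 => //; move: hi; rewrite !expg0 !perm1.
have [zB|zB] := dec_ft z (r pd); first by exists 0; rewrite // expg0 perm1.
have znd : z <> nd by move=> e; move: nd_cyc; rewrite -e zd.
have step (y : D) k : k <= i -> (mid * nx)%g z = y -> (exists2 j, j <= k & ((mid * nx) ^+ j)%g y = r pd) ->
    exists2 j, j <= i.+1 & ((mid * nx) ^+ j)%g z = r pd.
  move=> ki e [j jk hj]; exists j.+1; first exact: leq_ltn_trans jk _.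
  by rewrite expgS permM e.
have mphi (y : D) : y \in porbit phi d -> phi y \in porbit phi d.
  by move=> yd; apply: porbit_trans yd; apply: porbit_step.
have kA := rK nd; have kB := rK pd; have kz := rK z.
have [zA|zA] := dec_ft z (r nd).
  have e1 : phi z = pd by rewrite permM zA kA.
  have e2 : phi pd = nx (r pd) by rewrite permM.
  move: hi; rewrite expgS permM e1; case: i IH step => [|i] IH step.
    by rewrite expg0 perm1 => h; case: (rN (esym h)).
  rewrite expgS permM e2 => hi.
  apply: (step (nx (r pd)) i) => //.
    by rewrite permM zA /zip switch_revl.
  apply: IH hi _ _ => //; first by rewrite -e2 -e1; exact: (mphi _ (mphi _ zd)).
  by move/perm_inj.
have e : (mid * nx)%g z = phi z by rewrite permM zip_id ?permM //; congruence.
move: hi; rewrite expgS permM => hi.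
apply: (step (phi z) i) => //.
apply: IH hi _ _ => //; first exact: mphi.
by rewrite permM => /perm_inj; congruence.
Qed.

(** A number smaller than the degree of the origin of [d] locates [r pd] in the zipped map, which is
    enough to unzip it. *)
Lemma zip_rotation : exists2 j, j < #|porbit phi d| &
  ((mid * nx) ^+ j)%g nd' = r pd.
Proof.
have Bd : r pd \in porbit phi nd'.
  have h1 : d \in porbit phi (r pd) by apply: porbit_step; rewrite permM rK.
  have h2 : nd' \in porbit phi d by apply: porbit_step.
  by rewrite porbit_sym; apply: porbit_trans h2 h1.
have d'd : nd' \in porbit phi d by apply: porbit_step.
have [i hi iB] : exists2 i, i < #|porbit phi nd'| & r pd = (phi ^+ i)%g nd'.
  move: Bd; rewrite porbit_traject => /trajectP[i hi ->].
  by exists i; rewrite ?permX.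
have -> : #|porbit phi d| = #|porbit phi nd'|.
  by congr #|pred_of_set _|; apply/esym/eqP; rewrite eq_porbit_mem.
have [j ji hj] := zip_reach (esym iB) d'd (fun e => f2 (perm_inj e)).
by exists j => //; apply: leq_ltn_trans hi.
Qed.

(** One transposition merges the two ends of the edge of [d], the other splits off the tip [pd] of
    the folded triangle, a new vertex of degree 1. *)
Lemma zip_porbits : #|porbits (mid * nx)| = #|porbits phi|.
Proof.
have Bd : d \in porbit phi (r pd) by apply: porbit_step; rewrite permM rK.
rewrite /zip switch_porbits porbits_tperm_split //; last first.
  rewrite porbit_sym; apply: porbit_step.
  have kA := rK nd; have kB := rK pd.
  rewrite permM tpermD ?permM ?kA //; neq.
rewrite porbits_tperm_merge //.
apply: contra nd_cyc => h; apply: porbit_trans h _.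
by rewrite porbit_sym.
Qed.

(** The sides [r nd] and [r pd] are cut off from the folded triangle, but by [zip_rotation] [r pd]
    still shares a vertex with [nd']. *)
Lemma zip_joined : joined r nx -> joined mid nx.
Proof.
move=> rJ S hS hn; apply: rJ (hn).
have [j _ hj] := zip_rotation.
have hB : S (r pd) = S nd'.
  by rewrite -hj; apply: porbit_invariant (mem_porbit _ _ _) => z; rewrite permM hn hS.
have hA : S (r nd) = S (r pd) by rewrite -hS /zip switch_revl.
have hd : S d' = S d by rewrite -[in RHS]hS zip_edge.
apply: (switch_invariant rM nd_pd hS); last by rewrite hB !hn hd.
by rewrite hA hB !hn hd.
Qed.

End DistinctEnds.

End Zip.

(** * Cutting out a sphere made of two triangles *)

Section Excise.

Variables (m : {perm D}) (d : D).
Hypotheses (mM : matching m) (faceN : ~~ same_face nx d (m d)).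

Local Notation nd := (nx d).
Local Notation pd := (nx (nx d)).
Local Notation d' := (m d).
Local Notation nd' := (nx (m d)).
Local Notation pd' := (nx (nx (m d))).
Hypotheses (zipped : m nd = pd) (apart : m nd' <> pd').

Let mK z : m (m z) = z. Proof. by case: mM. Qed.
Let mN z : m z <> z. Proof. by case: mM => _ /(_ z). Qed.
Let k3 : nx pd = d. Proof. exact: n3. Qed.
Let k3' : nx pd' = d'. Proof. exact: n3. Qed.
Let ndd : nd <> d. Proof. exact: nN. Qed.
Let ndd' : nd' <> d'. Proof. exact: nN. Qed.
Let f1 : d' <> d. Proof. exact: mN. Qed.
Let f2 : d' <> nd. Proof. by move: faceN => /norP[_ /norP[/eqP]]. Qed.
Let f3 : d' <> pd. Proof. by move: faceN => /norP[_ /norP[_ /eqP]]. Qed.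
Let mm : m d' = d. Proof. exact: mK. Qed.
Let mpd : m pd = nd. Proof. by rewrite -zipped mK. Qed.

Local Notation q1 := (switch m nd pd').
Local Notation q := (excise m d).

Let nd_pd' : nd <> pd'. Proof. by congruence. Qed.
Let pd_nd' : pd <> nd'. Proof. by move/perm_inj; congruence. Qed.
Let q1M : matching q1. Proof. exact: switch_matching. Qed.

Let q1_nd' : q1 nd' = m nd'.
Proof. by have h := mK nd'; rewrite switch_id //; congruence. Qed.

Let q1_pd : q1 pd = m pd'.
Proof. by rewrite -zipped switch_revl. Qed.

Lemma excise_matching : matching q.
Proof. exact: switch_matching. Qed.

Lemma excise_edge : q d = d'.
Proof.
have h : q1 d = d' by rewrite switch_id //; congruence.
by rewrite /excise switch_id ?h //; congruence.
Qed.

Lemma excise_nd : q nd = pd'.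
Proof.
have h : q1 nd = pd' by apply: switch_l.
by rewrite /excise switch_id ?h //; congruence.
Qed.

Lemma excise_pd : q pd = nd'.
Proof. exact: switch_l. Qed.

Lemma excise_healed : q (m nd') = m pd'.
Proof. by rewrite -q1_nd' /excise switch_revr. Qed.

Lemma excise_id z : ~~ two_faces m d z -> ~~ two_faces m d (m z) -> q z = m z.
Proof.
rewrite /two_faces /same_face !negb_or -!andbA.
move=> /and5P[/eqP ? /eqP ? /eqP ? /eqP ? /andP[/eqP ? /eqP ?]].
move=> /and5P[/eqP ? /eqP ? /eqP ? /eqP ? /andP[/eqP ? /eqP ?]].
have h : q1 z = m z by rewrite switch_id //; congruence.
by rewrite /excise switch_id ?h //; congruence.
Qed.

Lemma excise_invariant (S : pred D) : invariant_under q S ->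
  S (m nd') = S nd' -> S (m pd') = S pd' -> S pd = S nd -> invariant_under m S.
Proof.
move=> hq e1 e2 e3; have e4 : S pd' = S pd by rewrite e3 -[RHS]hq excise_nd.
have hq1 : invariant_under q1 S.
  by apply: (switch_invariant q1M pd_nd' hq); rewrite ?q1_pd ?q1_nd' // e2.
by apply: (switch_invariant mM nd_pd' hq1); rewrite ?zipped.
Qed.

(** The detached sphere has three vertices, and only the vertex of degree 1 made by zipping is lost
    elsewhere. In terms of cycles, the first switch merges the fixed point [pd] into another cycle
    and splits one, and the second switch splits twice. *)
Lemma excise_porbits : #|porbits (q * nx)| = #|porbits (m * nx)| + 2.
Proof.
have mB := mK pd'; have mA := mK nd'; have nA := @mN nd'; have nB := @mN pd'.
have nA3 := n3 (m nd').
rewrite /excise switch_porbits q1_pd q1_nd'.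
rewrite porbits_tperm_split; first last.
- rewrite porbit_sym.
  apply: porbit_trans (porbit_step (y := d) _).
    apply: porbit_step; rewrite permM tpermD; try neq.
    by rewrite permM switch_id //; congruence.
  rewrite permM tpermD; try neq.
  by rewrite permM switch_revr // zipped.
- by congruence.
rewrite porbits_tperm_split; first last.
- apply: porbit_trans (porbit_step (y := pd') _).
    by apply: porbit_step; rewrite permM switch_r.
  by rewrite permM -q1_nd' q1M.1.
- by congruence.
rewrite addn2; congr _.+2.
rewrite switch_porbits zipped; apply/eqP; rewrite -eqSS; apply/eqP.
rewrite porbits_tperm_merge.
  apply: porbits_tperm_split; first congruence.
  apply: porbit_trans (porbit_step (y := d') _); last by rewrite permM mK.
  by apply: porbit_step; rewrite permM mm.
have inv : invariant_under (tperm nd (m pd') * (m * nx))%g (pred1 pd).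
  apply: stable_invariant => z /eqP ->; rewrite permM tpermD; try neq.
  by rewrite permM mpd /= eqxx.
rewrite porbit_sym; apply/negP => /(porbit_invariant inv) /=.
rewrite eqxx neqF_ft //; congruence.
Qed.

End Excise.
Lemma two_faces_invariant (r : {perm D}) d : invariant_under nx (two_faces r d).
Proof. by move=> z; rewrite /two_faces !same_face_next. Qed.

(** In the first alternative the triangle is already folded and [zip] does nothing ([zip_trivial]),
    so [d] need not have distinct ends. *)
Definition removable (r : {perm D}) d :=
  ~~ same_face nx d (r d) &&
  ((r (nx d) == nx (nx d)) || (r d \notin porbit (r * nx) d)).

(** * The whole surgery: genus and connectedness *)

Section Transplant.

Variables (r : {perm D}) (d x : D).
Hypotheses (rM : matching r) (rJ : joined r nx) (dR : removable r d).
Hypotheses (xN : ~~ two_faces r d x) (rxN : ~~ two_faces r d (r x)).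

Local Notation nd := (nx d).
Local Notation pd := (nx (nx d)).
Local Notation d' := (r d).
Local Notation nd' := (nx (r d)).
Local Notation pd' := (nx (nx (r d))).
Local Notation mid := (zip r d).
Local Notation q := (excise (zip r d) d).
Local Notation fin := (transplant r d x).

Let faceN : ~~ same_face nx d d'. Proof. by case/andP: dR. Qed.
Let midM : matching mid. Proof. exact: zip_matching. Qed.
Let midd : mid d = d'. Proof. exact: zip_edge. Qed.
Let midnd : mid nd = pd. Proof. exact: zip_zipped. Qed.

Let midJ : joined mid nx.
Proof.
case/andP: dR => _ /orP[/eqP e|e]; first by rewrite zip_trivial.
exact: zip_joined.
Qed.

Let midV : #|porbits (mid * nx)| = #|porbits (r * nx)|.
Proof.
case/andP: dR => _ /orP[/eqP e|e]; first by rewrite zip_trivial.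
exact: zip_porbits.
Qed.

Let midN : ~~ same_face nx d (mid d). Proof. by rewrite midd. Qed.

Let two_faces_d : two_faces r d d. Proof. by rewrite /two_faces /same_face eqxx. Qed.
Let two_faces_d' : two_faces r d d'.
Proof. by rewrite /two_faces /same_face eqxx !orbT. Qed.

Let two_facesP z : two_faces r d z ->
  z \in [:: d; nd; pd; d'; nd'; pd'].
Proof. by rewrite /two_faces /same_face !inE -!orbA. Qed.

(** Otherwise the two faces would form a component of their own, while [x] lies outside them. *)
Let apart : mid (nx (mid d)) <> nx (nx (mid d)).
Proof.
rewrite midd => e.
have h : invariant_under mid (two_faces r d).
  have [mK _] := midM; have e2 : mid pd' = nd' by rewrite -e mK.
  have e3 : mid pd = nd by rewrite -midnd mK.
  have e4 : mid d' = d by rewrite -midd mK.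
  apply: stable_invariant => z /two_facesP; rewrite !inE.
  case/or4P => [/eqP ->|/eqP ->|/eqP ->|]; [| | |case/or3P => /eqP ->];
    by rewrite ?midd ?midnd ?e3 ?e4 ?e ?e2 ?two_faces_invariant.
by case/negP: xN; rewrite (midJ h (two_faces_invariant _ _) x d).
Qed.

Let qM : matching q. Proof. exact: excise_matching. Qed.
Let qd : q d = d'. Proof. by rewrite excise_edge. Qed.
Let qnd : q nd = pd'. Proof. by rewrite excise_nd // midd. Qed.
Let qpd : q pd = nd'. Proof. by rewrite excise_pd // midd. Qed.
Let qd' : q d' = d. Proof. by rewrite -qd qM.1. Qed.
Let qnd' : q nd' = pd. Proof. by rewrite -qpd qM.1. Qed.
Let qpd' : q pd' = nd. Proof. by rewrite -qnd qM.1. Qed.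

Let q_two_faces : invariant_under q (two_faces r d).
Proof.
apply: stable_invariant => z /two_facesP; rewrite !inE.
by case/or4P => [/eqP ->|/eqP ->|/eqP ->|]; [| | |case/or3P => /eqP ->];
  rewrite ?qd ?qnd ?qpd ?qd' ?qnd' ?qpd' ?two_faces_invariant.
Qed.

Let mid_out z : ~~ two_faces r d z -> ~~ two_faces r d (r z) -> mid z = r z.
Proof.
rewrite /two_faces /same_face !negb_or -!andbA.
move=> /and5P[/eqP ? /eqP ? /eqP ? /eqP ? /andP[/eqP ? /eqP ?]].
move=> /and5P[/eqP ? /eqP ? /eqP ? /eqP ? /andP[/eqP ? /eqP ?]].
exact: zip_id.
Qed.

Let q_out z : ~~ two_faces r d z -> ~~ two_faces r d (r z) -> q z = r z.
Proof.
move=> h1 h2; have e := mid_out h1 h2.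
by rewrite excise_id ?e // /two_faces midd.
Qed.

Lemma excise_zip_x : q x = r x.
Proof. exact: q_out. Qed.

Let qx := excise_zip_x.

Let x_d : x <> d. Proof. by move=> e; move: xN; rewrite e two_faces_d. Qed.

Lemma transplant_matching : matching fin.
Proof. exact: switch_matching. Qed.

Lemma transplant_x : fin x = d.
Proof. exact: switch_l. Qed.

Lemma transplant_d : fin d = x.
Proof. exact: switch_r. Qed.

Lemma transplant_rx : fin (r x) = d'.
Proof. by rewrite -qx /transplant /graft switch_revl. Qed.

Lemma transplant_rd : fin d' = r x.
Proof. by rewrite -(transplant_matching.1 (r x)) transplant_rx. Qed.

Let fin_eq_q z : two_faces r d z -> z <> d -> z <> d' -> fin z = q z.
Proof.
move=> hz zd zd'; rewrite /transplant /graft switch_id //.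
- by move=> e; move: hz; rewrite e (negbTE xN).
- by move=> e; move: hz; rewrite -q_two_faces e (negbTE xN).
- by move=> e; apply: zd'; rewrite -(qM.1 z) e qd.
Qed.

Let f1 : d' <> d. Proof. exact: rM.2. Qed.
Let f2 : d' <> nd. Proof. by move: faceN => /norP[_ /norP[/eqP]]. Qed.
Let f3 : d' <> pd. Proof. by move: faceN => /norP[_ /norP[_ /eqP]]. Qed.

Lemma transplant_nd : fin nd = pd'.
Proof.
have := @nN d; have := two_faces_d; rewrite -two_faces_invariant => ? ?.
by rewrite fin_eq_q //; congruence.
Qed.

Lemma transplant_pd : fin pd = nd'.
Proof.
have := n3 d; have := @nN d; have := two_faces_d.
rewrite -two_faces_invariant -two_faces_invariant => ? ? ?.
by rewrite fin_eq_q //; congruence.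
Qed.

Lemma transplant_rnd : fin nd' = pd.
Proof. by rewrite -(transplant_matching.1 pd) transplant_pd. Qed.

Lemma transplant_rpd : fin pd' = nd.
Proof. by rewrite -(transplant_matching.1 nd) transplant_nd. Qed.

Lemma transplant_id z : ~~ two_faces r d z -> ~~ two_faces r d (r z) ->
  z <> x -> z <> r x -> fin z = r z.
Proof.
move=> hz hrz zx zrx; have qz := q_out hz hrz.
have rz := rM.1 z; have kx := rM.1 x.
rewrite /transplant /graft switch_id ?qz //.
- by move=> e; move: hz; rewrite e two_faces_d.
- congruence.
- by move=> e; move: hrz; rewrite e two_faces_d.
Qed.

(** Grafting merges two vertices of the sphere with the ends of the edge of [x], which cancels the 2
    gained in [excise_porbits]. *)
Lemma transplant_porbits : #|porbits (fin * nx)| = #|porbits (r * nx)|.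
Proof.
have e := excise_porbits midM midN midnd apart.
rewrite -midV; apply/eqP; rewrite -(eqn_add2r 2) -e.
have k3 := n3 d; have k3' := n3 d'.
apply/eqP; apply: (@switch_porbits_merge _ _ _ _ _
  (fun z => z \in [:: d'; nd]) (fun z => z \in [:: d; nd'])).
- apply: stable_invariant => z; rewrite !inE permM.
  by case/orP => /eqP ->; rewrite ?qd' ?qnd ?k3' eqxx ?orbT.
- apply: stable_invariant => z; rewrite !inE permM.
  by case/orP => /eqP ->; rewrite ?qd ?qnd' ?k3 eqxx ?orbT.
- by rewrite qd !inE eqxx.
- apply: contra xN; rewrite !inE.
  by case/orP => /eqP ->; rewrite ?two_faces_invariant.
- by rewrite !inE eqxx.
- apply: contra rxN; rewrite !inE qx.
  by case/orP => /eqP ->; rewrite ?two_faces_invariant.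
- apply: contra xN; rewrite !inE.
  by case/orP => /eqP ->; rewrite ?two_faces_invariant.
- have := @nN d'; rewrite qd !inE negb_or => h.
  by rewrite !neqF_ft //; congruence.
Qed.

(* If the two components meeting the healed edge [mid nd', mid pd'] were
   separated from [x], the rest of the component of [x] would be closed in
   [mid]. *)
Lemma transplant_joined : joined fin nx.
Proof.
move=> S hS hn.
have Sxd : S d = S x by rewrite -[in RHS]hS transplant_x.
have Srx : S (r x) = S d' by rewrite -[in LHS]hS transplant_rx.
have Sdd' : S d' = S d.
  have e : S nd = S pd' by rewrite -hS transplant_nd.
  by move: e; rewrite !hn => ->.
have hq : invariant_under q S.
  apply: (switch_invariant qM x_d hS); rewrite ?qd ?qx //; congruence.
have heal : S (mid pd') = S (mid nd').
  have := excise_healed midM midnd apart; rewrite midd => <-.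
  by rewrite hq.
have [e|e] := eqVneq (S (mid nd')) (S x).
  have hm := excise_invariant midM midnd apart hq.
  by apply: midJ => //; apply: hm; rewrite ?midd ?heal ?e !hn ?Sdd' ?Sxd.
have h : invariant_under mid (fun z => (S z == S x) && ~~ two_faces r d z).
  apply: (excise_invariant midM midnd apart).
  - by move=> z /=; rewrite hq q_two_faces.
  - by rewrite midd /= (negbTE e) !two_faces_invariant two_faces_d' andbF.
  - by rewrite midd /= heal (negbTE e) !two_faces_invariant two_faces_d' andbF.
  - by rewrite /= !two_faces_invariant two_faces_d !andbF.
have hx : invariant_under nx (fun z => (S z == S x) && ~~ two_faces r d z).
  by move=> z /=; rewrite hn two_faces_invariant.
by have := midJ h hx x d; rewrite /= eqxx (negbTE xN) two_faces_d andbF.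
Qed.

End Transplant.
End Surgery.

(** * Counting the contractions *)

Section Removals.

Variables (D : finType) (nx : {perm D}) (K : nat).
Hypothesis nxT : triangular nx.

Let n3 z : nx (nx (nx z)) = z. Proof. by case: nxT. Qed.
Let nN z : nx z <> z. Proof. by case: nxT => _ /(_ z). Qed.

(** [removable], with a bound on the degree that limits the choices for the rotation of
    [zip_rotation] to [K]. *)
Definition cheap (r : {perm D}) d :=
  ~~ same_face nx d (r d) &&
  ((r (nx d) == nx (nx d)) ||
   (r d \notin porbit (r * nx) d) && (#|porbit (r * nx) d| <= K)).

Lemma cheap_removable r d : cheap r d -> removable nx r d.
Proof.
by case/andP => h1 /orP[h2|/andP[h2 _]]; rewrite /removable h1 h2 ?orbT.
Qed.

(* Recovers [r], [x] and [d] from [transplant nx r d x], the image [w] of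
   [nx (r d)], the other half [al] of an edge that was healed and, unless
   [r (nx d) = nx (nx d)], a bounded number of rotation steps. *)
Definition untransplant (s : {perm D}) (w al : D) (oj : option 'I_K) :
    {perm D} * D * D :=
  let pd := s w in let d := nx pd in let nd := nx d in
  let q := switch s (s d) (s (nx (nx w))) in
  let m := switch (switch q pd al) nd pd in
  (switch m nd (if oj is Some j then m (((m * nx) ^+ j)%g w) else pd), s d, d).

Lemma untransplantK r d x : matching r -> joined r nx -> cheap r d ->
  ~~ two_faces nx r d x -> ~~ two_faces nx r d (r x) ->
  exists al oj, untransplant (transplant nx r d x) (nx (r d)) al oj = (r, x, d).
Proof.
move=> rM rJ dC xN rxN.
have dR := cheap_removable dC; have [faceN _] := andP dR.
have nd_pd : nx d <> nx (nx d) by move=> /esym; apply: nN.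
have midM : matching (zip nx r d) by apply: zip_matching.
have midd : zip nx r d d = r d by apply: zip_edge.
have midnd : zip nx r d (nx d) = nx (nx d) by apply: zip_zipped.
set m := zip nx r d in midM midd midnd.
set q1 := switch m (nx d) (nx (nx (r d))).
have rdd := rM.2 d.
have a1 : nx d <> nx (nx (r d)).
  have /norP[/eqP ? /norP[/eqP ? /eqP ?]] := faceN.
  by have := n3 (r d); congruence.
have a2 : nx (nx d) <> nx (r d).
  have /norP[/eqP ? /norP[/eqP ? /eqP ?]] := faceN.
  by move/perm_inj; congruence.
have a3 : x <> d by move=> e; move: xN; rewrite e /two_faces /same_face eqxx.
have q1M : matching q1 by apply: switch_matching.
have qM : matching (excise nx m d).
  by rewrite /excise midd; apply: switch_matching.
have fin_w : transplant nx r d x (nx (r d)) = nx (nx d) by apply: transplant_rnd.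
have fin_d : transplant nx r d x d = x by apply: transplant_d.
have fin_d' : transplant nx r d x (r d) = r x by apply: transplant_rd.
have qx : excise nx m d x = r x by apply: excise_zip_x.
have eq_q : switch (transplant nx r d x) x (r x) = excise nx m d.
  by rewrite -qx /transplant /graft switchK.
have eq_q1 : switch (excise nx m d) (nx (nx d)) (q1 (nx (nx d))) = q1.
  by rewrite /excise midd switchK.
have eq_m : switch q1 (nx d) (nx (nx d)) = m.
  by rewrite -[X in switch _ _ X]midnd switchK.
have eq_r : switch m (nx d) (r (nx d)) = r by rewrite switchK.
exists (q1 (nx (nx d))).
case/andP: dC => _ /orP[/eqP e|/andP[endsN sizeK]].
  exists None; rewrite /untransplant fin_w !n3 fin_d fin_d' eq_q eq_q1 eq_m.
  by rewrite -e eq_r.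
have [j jK hj] := zip_rotation nxT rM faceN endsN.
exists (Some (Ordinal (leq_trans jK sizeK))).
rewrite /untransplant fin_w !n3 fin_d fin_d' eq_q eq_q1 eq_m /= hj.
by rewrite [m _]switch_revr // eq_r.
Qed.

(** Four switches, each altering at most four darts. *)
Lemma card_transplant_neq r d x : matching r -> joined r nx -> cheap r d ->
  ~~ two_faces nx r d x -> ~~ two_faces nx r d (r x) ->
  #|[set z | transplant nx r d x z != r z]| <= 16.
Proof.
move=> rM rJ dC xN rxN.
have dR := cheap_removable dC; have [faceN _] := andP dR.
have nd_pd : nx d <> nx (nx d) by move=> /esym; apply: nN.
have midM : matching (zip nx r d) by apply: zip_matching.
have midd : zip nx r d d = r d by apply: zip_edge.
have a1 : nx d <> nx (nx (r d)).
  have /norP[/eqP ? /norP[/eqP ? /eqP ?]] := faceN.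
  by have := n3 (r d); congruence.
have a2 : nx (nx d) <> nx (r d).
  have /norP[/eqP ? /norP[/eqP ? /eqP ?]] := faceN.
  by move/perm_inj; congruence.
have a3 : x <> d by move=> e; move: xN; rewrite e /two_faces /same_face eqxx.
have q1M := switch_matching midM a1.
have qM := switch_matching q1M a2.
have c1 := card_switch_neq rM nd_pd.
have c2 := card_switch_neq midM a1.
have c3 := card_switch_neq q1M a2.
have c4 := card_switch_neq qM a3.
rewrite /transplant /graft /excise midd.
apply: leq_trans (leq_add (leq_add c1 c2) (leq_add c3 c4)).
apply: leq_trans (leq_add (leq_card_setU _ _) (leq_card_setU _ _)).
apply: leq_trans (leq_card_setU _ _).
apply/subset_leq_card/fintype.subsetP => z; rewrite !inE.
apply: contraR; rewrite !negb_or !negbK.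
by case/andP => /andP[/eqP e1 /eqP e2] /andP[/eqP e3 /eqP e4]; rewrite e4 e3 e2 e1.
Qed.

(** A fixed point is a vertex of degree 1: its triangle is folded around it, and the side opposite
    to it qualifies by the first alternative of [cheap]. *)
Lemma cheap_fixed r e : matching r -> (r * nx)%g e = e -> cheap r (nx e).
Proof.
move=> rM; rewrite permM => re.
have e1 : r e = nx (nx e) by apply: (@perm_inj _ nx); rewrite re n3.
have e2 : r (nx (nx e)) = e by rewrite -e1 rM.1.
have e3 := @nN e; have e4 := @nN (nx e); have e5 := rM.2 (nx e); have e6 := rM.1 (nx e).
rewrite /cheap n3 e2 eqxx andbT; apply/norP; split; first exact: neq_ft.
by apply/norP; split; apply: neq_ft; rewrite ?n3; congruence.
Qed.

(** As there is another vertex, connectedness gives a dart [e] of [u] whose reverse is not in [u].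
    It is cheap unless [r e] lies in the face of [e]; this face is then folded around a vertex of
    degree 1, and [cheap_fixed] applies to it. *)
Lemma cheap_near_small_cycle r (u : {set D}) : matching r -> joined r nx ->
  1 < #|porbits (r * nx)| -> u \in porbits (r * nx) -> #|u| <= K ->
  exists2 e, e \in u & [|| cheap r e, cheap r (nx e) | cheap r (nx (nx e))].
Proof.
move=> rM rJ V2 uV uK.
have uE e : e \in u -> u = porbit (r * nx) e.
  case/imsetP: uV => a _ -> ea; apply/esym/eqP.
  by rewrite eq_porbit_mem.
have u_inv e : e \in u -> (r * nx)%g e \in u.
  by move=> eu; rewrite (uE _ eu); apply: porbit_step.
have [/existsP[e /andP[eu /eqP efix]]|/existsPn nofix] :=
    boolP [exists e, (e \in u) && ((r * nx)%g e == e)].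
  by exists e => //; rewrite cheap_fixed ?orbT.
have [e eu reu] : exists2 e, e \in u & r e \notin u.
  have [/existsP[e /andP[]]|/existsPn h] :=
      boolP [exists e, (e \in u) && (r e \notin u)]; first by exists e.
  have ur : invariant_under r (mem u).
    apply: stable_invariant => z zu /=.
    by have := h z; rewrite negb_and negbK (zu : z \in u).
  have un : invariant_under nx (mem u).
    apply: stable_invariant => z zu /=.
    have := u_inv (r z); rewrite permM rM.1; apply.
    by have := ur z => /= ->.
  have [a _ ua] := imsetP uV.
  suff : #|porbits (r * nx)| <= 1 by rewrite leqNgt V2.
  rewrite -(cards1 u); apply/subset_leq_card/fintype.subsetP => w /imsetP[b _ ->].
  have bu : b \in u.
    have := rJ _ ur un b a => /= ->.
    by rewrite ua porbit_id.
  by rewrite inE (uE _ bu).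
exists e => //.
have fixN (z : D) : z \in u -> (r * nx)%g z <> z.
  by move=> zu ez; have := nofix z; rewrite zu ez eqxx.
have efix := fixN _ eu.
have [e1|e1] := dec_ft (r e) (nx e).
  have := @cheap_fixed r (r e) rM; rewrite permM rM.1 e1 => -> //.
  by rewrite !orbT.
rewrite [X in X || _]/cheap -(uE _ eu) reu uK orbT andbT.
apply/orP; left; apply/norP; split; first exact/neq_ft/rM.2.
apply/norP; split; apply: neq_ft => // e2.
by apply: efix; rewrite permM e2 n3.
Qed.

Definition small_cycles (r : {perm D}) := [set u in porbits (r * nx) | #|u| <= K].

(** A cheap dart is charged by at most the three vertices of its face. *)
Lemma card_cheap r : matching r -> joined r nx -> 1 < #|porbits (r * nx)| ->
  #|small_cycles r| <= 3 * #|[set d | cheap r d]|.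
Proof.
move=> rM rJ V2; set C := [set d | cheap r d].
pose f i d := porbit (r * nx)%g ((nx ^+ i)%g d).
have sub : small_cycles r \subset f 0 @: C :|: (f 1 @: C :|: f 2 @: C).
  apply/fintype.subsetP => u; rewrite inE => /andP[uV uK].
  have [e eu] := cheap_near_small_cycle rM rJ V2 uV uK.
  have uE : u = porbit (r * nx) e.
    case/imsetP: uV eu => a _ -> ea; apply/esym/eqP.
    by rewrite eq_porbit_mem.
  rewrite uE !inE => /or3P[h|h|h].
  - apply/orP; left; apply/imsetP; exists e; first by rewrite inE.
    by rewrite /f expg0 perm1.
  - apply/orP; right; apply/orP; right; apply/imsetP; exists (nx e); first by rewrite inE.
    by rewrite /f !expgS expg0 mulg1 permM n3.
  - apply/orP; right; apply/orP; left; apply/imsetP; exists (nx (nx e)); first by rewrite inE.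
    by rewrite /f expg1 n3.
apply: leq_trans (subset_leq_card sub) _.
apply: leq_trans (leq_card_setU _ _) _; rewrite !mulSn addn0.
apply: leq_add; first exact: leq_imset_card.
apply: leq_trans (leq_card_setU _ _) _.
by apply: leq_add; apply: leq_imset_card.
Qed.

Lemma porbits_partition (p : {perm D}) : finset.partition (porbits p) [set: D].
Proof.
have := @equivalence_partitionP _ (fun x y => y \in porbit p x) [set: D].
have -> : equivalence_partition (fun x y => y \in porbit p x) [set: D] = porbits p.
  apply/setP => u; apply/imsetP/imsetP => -[x _ ->]; exists x => //;
    by apply/setP => y; rewrite !inE.
apply=> x y z _ _ _; split=> [|/=]; first exact: porbit_id.
by rewrite -eq_porbit_mem => /eqP ->.
Qed.

(** Markov's inequality: a cycle that is not small uses at least [K.+1] darts. *)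
Lemma card_small_cycles r :
  #|porbits (r * nx)| * K.+1 <= #|D| + #|small_cycles r| * K.+1.
Proof.
have <- : #|[set: D]| = #|D| by rewrite cardsT.
rewrite (card_partition (porbits_partition (r * nx))).
have -> : #|porbits (r * nx)| =
    #|small_cycles r| + #|porbits (r * nx) :\: small_cycles r|.
  rewrite -(cardsID (small_cycles r)); congr (_ + _).
  by apply: eq_card => u; rewrite !inE andbA andbb.
rewrite mulnDl addnC leq_add2r (big_setID (small_cycles r)) /=.
apply: leq_trans (leq_addl _ _); rewrite -sum_nat_const.
apply: leq_sum => u; rewrite !inE => /andP[h uP].
by move: h; rewrite uP /= -ltnNge.
Qed.

(** For each [z], either [d] or [r d] is one of the three darts of the face of [z]. *)
Lemma card_touching r (L : {set D}) :
  #|[set d | [exists z in L, two_faces nx r d z]]| <= 6 * #|L|.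
Proof.
pose f (g : D -> D) i (z : D) := g ((nx ^+ i)%g z).
pose U g := f g 0 @: L :|: (f g 1 @: L :|: f g 2 @: L).
have cU g : #|U g| <= 3 * #|L|.
  apply: leq_trans (leq_card_setU _ _) _; rewrite !mulSn addn0.
  apply: leq_add; first exact: leq_imset_card.
  apply: leq_trans (leq_card_setU _ _) _.
  by apply: leq_add; apply: leq_imset_card.
have mU g d z : z \in L -> same_face nx d z -> g d \in U g.
  move=> zL /or3P[] /eqP e; rewrite !inE.
  - apply/orP; left; apply/imsetP; exists z => //.
    by rewrite /f expg0 perm1 e.
  - apply/orP; right; apply/orP; right; apply/imsetP; exists z => //.
    by rewrite /f !expgS expg0 mulg1 permM e n3.
  - apply/orP; right; apply/orP; left; apply/imsetP; exists z => //.
    by rewrite /f expg1 e n3.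
rewrite (_ : 6 = 3 + 3) // mulnDl.
apply: leq_trans (leq_add (cU id) (cU (r^-1)%g)).
apply: leq_trans (leq_card_setU _ _).
apply/subset_leq_card/fintype.subsetP => d; rewrite inE.
case/existsP => z /andP[zL /orP[h|h]]; apply/setUP; [left | right].
  exact: mU zL h.
by rewrite -[d](permK r); apply: mU zL h.
Qed.

End Removals.

(** The average degree is at most [6 * M], so at least half of the vertices have degree at most
    [12 * M]. This gives at least [#|D| / (36 * M)] cheap darts, of which at most [6 * l], hence at
    most half of that number, touch [L]. *)
Lemma card_cheap_avoiding (D : finType) (nx r : {perm D}) (M l : nat) (L : {set D}) :
  triangular nx -> matching r -> joined r nx -> 1 < #|porbits (r * nx)| ->
  #|D| <= 6 * M * #|porbits (r * nx)| -> #|L| <= l -> 432 * M * l <= #|D| ->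
  #|D| <= 72 * M *
    #|[set d | cheap nx (12 * M) r d & [forall z in L, ~~ two_faces nx r d z]]|.
Proof.
move=> nxT rM rJ V2 hV hL hl.
have h1 := card_small_cycles nx (12 * M) r.
have h2 := card_cheap (12 * M) nxT rM rJ V2.
have h3 := card_touching nxT r L.
set C := [set d | cheap nx (12 * M) r d] in h2.
set T := [set d | [exists z in L, two_faces nx r d z]] in h3.
have -> : [set d | cheap nx (12 * M) r d & [forall z in L, ~~ two_faces nx r d z]] = C :\: T.
  apply/setP => d; rewrite !inE andbC; congr andb.
  by rewrite negb_exists; apply: eq_forallb => z; rewrite negb_and implybE.
have h4 : #|C| <= #|C :\: T| + #|T|.
  by rewrite -(cardsID T C) addnC leq_add2l subset_leq_card // subsetIr.
nia.
Qed.

(** * Ladders *)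

Section InsertionTheory.

Variables (B : bigon) (d : B) (k : nat).

Lemma iter_insertion_next i (y : B) :
  iter i (@insertion_next B k) (inl y) = inl (iter i (@bnext B) y).
Proof. by elim: i => //= i ->. Qed.

Lemma inner_insertion_inl (y : B) :
  ((inl y : insertion d k) \in inner_darts (insertion d k)) = (y \in inner_darts B).
Proof.
rewrite !inE; congr negb; apply/idP/idP.
  move/iter_findex; rewrite iter_insertion_next => -[<-].
  exact: fconnect_iter.
by move/iter_findex <-; rewrite -iter_insertion_next; apply: fconnect_iter.
Qed.

Lemma inner_insertion_inr z : (inr z : insertion d k) \in inner_darts (insertion d k).
Proof.
by rewrite !inE; apply/negP => /iter_findex; rewrite iter_insertion_next.
Qed.

End InsertionTheory.

Lemma ladder_tentacle k :
  tentacle (projT1 (ladder_rec k)) /\ projT2 (ladder_rec k) \in bfree (projT1 (ladder_rec k)).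
Proof.
elim: k => [|k]; first by split; [constructor | rewrite inE].
rewrite /=; case: (ladder_rec k) => B d /= [tB dB].
by split; [constructor | rewrite inE].
Qed.

Lemma card_ladder k : #|projT1 (ladder_rec k)| = 6 * k + 2.
Proof.
elim: k => [|k]; first by rewrite /= card_bool.
rewrite /=; case: (ladder_rec k) => B d /= h.
rewrite card_sum !card_prod !card_ord card_bool h /Zp_trunc /=; lia.
Qed.

Lemma ladder_matching k (z : projT1 (ladder_rec k)) :
  brev (brev z) = z /\ brev z <> z.
Proof.
elim: k z => [|k]; first by case.
rewrite /=; case: (ladder_rec k) => B d /= h.
have hK : involutive (@brev B) by move=> y; case: (h y).
case=> [y|[[i s] j]] /=.
  have [->|yd] := eqVneq y d.
    by split; rewrite //= ?eqxx // -[_ == _]/true /=.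
  have [->|yd'] := eqVneq y (brev d); first by split.
  rewrite /= (inv_eq hK) (negbTE yd').
  rewrite (inj_eq (can_inj hK)) (negbTE yd) hK; split=> //.
  by case; case: (h y).
rewrite !ord1; have [->|j0] := eqVneq j 0%R.
  case: s; rewrite /= ?eqxx /=.
    by split=> //; congr (inr (_, _, _)); apply: val_inj.
  by split=> //; case: eqP => // /(proj2 (h d)).
rewrite /= GRing.oppr_eq0 j0 negbK GRing.opprK; split=> //.
by case; case: s.
Qed.

Lemma Z3_cases (j : 'Z_3) : [\/ j = 0%R, j = 1%R | j = (1 + 1)%R].
Proof.
case: j => -[|[|[|//]]] h; [apply: Or31|apply: Or32|apply: Or33]; exact: val_inj.
Qed.

(* Closure under [bnext] is only asked at inner darts: this is what two
   embeddings are required to preserve. *)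
Lemma ladder_connected k (Q : pred (projT1 (ladder_rec k))) :
  (forall z, Q z -> Q (brev z)) ->
  (forall z, z \in inner_darts _ -> Q z -> Q (bnext z)) ->
  forall u v, Q u -> Q v.
Proof.
elim: k Q => [|k] /=.
  move=> Q hr _ u v Qu; have := hr _ Qu.
  by case: u v Qu => -[].
have := @ladder_matching k.
case: (ladder_rec k) => B d /= hM IH Q hr hn u v Qu.
have hK : involutive (@brev B) by move=> y; case: (hM y).
have step z : Q (inr z) -> Q (insertion_next (inr z)).
  by apply: hn; apply: inner_insertion_inr.
have rev z : Q z -> Q (insertion_rev d z) := hr z.
have e1 : (0 + 1 : 'Z_3)%R = 1%R by apply: val_inj.
have e2 : (1 + 1 + 1 : 'Z_3)%R = 0%R by apply: val_inj.
have e3 : (- 1 : 'Z_3)%R = (1 + 1)%R by apply: val_inj.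
have e4 : (- (1 + 1) : 'Z_3)%R = 1%R by apply: val_inj.
have fwd i s j : Q (inr (i, s, 0%R)) -> Q (inr (i, s, j)).
  move=> h0; have /= h1 := step _ h0; rewrite e1 in h1; have /= h2 := step _ h1.
  by case: (Z3_cases j) => ->.
have bwd i s j : Q (inr (i, s, j)) -> Q (inr (i, s, 0%R)).
  case: (Z3_cases j) => -> // h; have /= h1 := step _ h; last by rewrite e2 in h1.
  by have /= h2 := step _ h1; rewrite e2 in h2.
have flip s : Q (inr (ord0, s, 0%R)) -> Q (inr (ord0, ~~ s, 0%R)).
  by move/(@fwd _ _ 1%R)/rev => /= h; apply: bwd h.
have to_d : Q (inr (ord0, true, 0%R)) -> Q (inl d).
  by move/rev.
have to_d' : Q (inr (ord0, false, 0%R)) -> Q (inl (brev d)) by move/rev.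
have of_d : Q (inl d) -> Q (inr (ord0, true, 0%R)).
  by move/rev => /=; rewrite eqxx (_ : ord_max = ord0) //; apply: val_inj.
have of_d' : Q (inl (brev d)) -> Q (inr (ord0, true, 0%R)).
  move=> h; have := rev _ h; rewrite /=.
  case: eqP => [e _|_]; first by apply: of_d; rewrite -e.
  by rewrite eqxx => /(@flip false).
have all_inl y : Q (inl y) -> forall y', Q (inl y').
  move=> Qy y'; apply: (IH (fun y => Q (inl y)) _ _ y y' Qy) => z.
    move=> Qz; have [zd|zd] := eqVneq z d.
      by rewrite zd in Qz *; apply/to_d'/(@flip true)/of_d.
    have [zd'|zd'] := eqVneq z (brev d).
      by rewrite zd' in Qz *; rewrite hK; apply/to_d/of_d'.
    by have := rev _ Qz; rewrite /= (negbTE zd) (negbTE zd').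
  by move=> zi Qz; apply: (hn (inl z)) => //; rewrite inner_insertion_inl.
have [y Qy] : exists y, Q (inl y).
  case: u Qu => [y|[[i s] j]]; first by exists y.
  rewrite ord1 => /bwd; case: s; first by move/to_d; exists d.
  by move/to_d'; exists (brev d).
case: v => [y'|[[i s] j]]; first exact: all_inl Qy _.
rewrite ord1; apply: fwd.
have h : Q (inr (ord0, true, 0%R)) by apply/of_d/(all_inl _ Qy).
by case: s => //; apply: flip h.
Qed.

Lemma ladder_embedding_eq (D : finType) (r nx : D -> D) k
    (f g : projT1 (ladder_rec k) -> D) p :
  embedding r nx f -> embedding r nx g -> f p = g p -> f =1 g.
Proof.
move=> [_ fr fn] [_ gr gn] /eqP e q; apply/eqP.
apply: (ladder_connected (Q := fun z => f z == g z)) e => z.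
  by move/eqP => e; rewrite fr gr e.
by move=> zi /eqP e; rewrite fn // gn // e.
Qed.

Definition insertion_map (B : bigon) (d : B) (D : finType) (r nx : {perm D})
    (f : B -> D) (e : D) (z : insertion d 0) : D :=
  match z with
  | inl y => f y
  | inr (_, s, j) => (nx ^+ (j : nat))%g (if s then e else r e)
  end.

(** Since the copy avoids the two transplanted faces, its only edge that is reglued is the one of
    [f d], and the two faces fill the 2-gon opened there as in [insertion]. *)
Lemma embedding_transplant (B : bigon) (d : B) (D : finType) (r nx : {perm D})
    (f : B -> D) (e : D) :
  triangular nx -> matching r -> joined r nx -> removable nx r e ->
  (forall y : B, brev (brev y) = y) -> (forall y : B, brev y <> y) ->
  embedding r nx f -> (forall y, ~~ two_faces nx r e (f y)) ->
  embedding (transplant nx r e (f d)) nx (@insertion_map B d D r nx f e).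
Proof.
move=> nxT rM rJ eR bK bN [fI fr fn] fN.
have rfd : r (f d) = f (brev d) by rewrite fr.
have xN := fN d; have rxN : ~~ two_faces nx r e (r (f d)) by rewrite rfd.
have [faceN _] := andP eR; case/norP: faceN => /eqP n1 /norP[/eqP n2 /eqP n3].
have k0 := nxT.1 e; have k1 := nxT.1 (r e).
have m0 := nxT.2 e; have m1 := nxT.2 (r e); have m2 := nxT.2 (nx e).
have m3 := nxT.2 (nx (r e)).
have E0 (p : {perm D}) z : (p ^+ 0)%g z = z by rewrite expg0 perm1.
have E2 (p : {perm D}) z : (p ^+ 2)%g z = p (p z) by rewrite expgS expg1 permM.
have e3 : (- 1 : 'Z_3)%R = (1 + 1)%R by apply: val_inj.
have e4 : (- (1 + 1) : 'Z_3)%R = 1%R by apply: val_inj.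
have v2 : ((1 + 1)%R : 'Z_3) = 2 :> nat by [].
have v1 : (1%R : 'Z_3) = 1 :> nat by [].
have v0 : (0%R : 'Z_3) = 0 :> nat by [].
have inN i s j y : @insertion_map B d D r nx f e (inr (i, s, j)) <> f y.
  move=> h; have := fN y; rewrite -h /insertion_map.
  have -> n z : two_faces nx r e ((nx ^+ n)%g z) = two_faces nx r e z.
    elim: n z => [|n IH] z; rewrite ?E0 // expgS permM IH.
    exact: two_faces_invariant.
  by case: s {h}; rewrite /two_faces /same_face eqxx ?orbT.
split.
- move=> [y|[[i s] j]] [y'|[[i' s'] j']].
  + by move/fI ->.
  + by move/esym/inN.
  + by move/inN.
  + rewrite !ord1 /insertion_map.
    case: (Z3_cases j) (Z3_cases j') => -> [] ->; rewrite ?v0 ?v1 ?v2 ?E0 ?E2 ?expg1;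
    case: s; case: s' => // h; exfalso; congruence.
- case=> [y|[[i s] j]] /=.
    have [->|yd] := eqVneq y d; first by rewrite /= ?v0 E0 transplant_x.
    have [->|yd'] := eqVneq y (brev d).
      by rewrite /= ?v0 E0 -rfd transplant_rx.
    rewrite /= fr transplant_id // -?fr ?rfd //.
      by move/fI/eqP; rewrite (negbTE yd).
    by move/fI/eqP; rewrite (negbTE yd').
  rewrite !ord1.
  case: (Z3_cases j) => -> /=; rewrite ?e3 ?e4 ?v0 ?v1 ?v2 ?E0 ?E2 ?expg1.
  + case: s => /=; first by rewrite transplant_d.
    by rewrite transplant_rd // rfd.
  + case: s => /=; first by rewrite transplant_nd.
    by rewrite transplant_rnd.
  + case: s => /=; first by rewrite transplant_pd.
    by rewrite transplant_rpd.
- case=> [y|[[i s] j]] /= zi.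
    by apply: fn; rewrite -(inner_insertion_inl d 0).
  case: (Z3_cases j) => ->; rewrite ?v0 ?v1 ?v2 ?E0 ?E2 ?expg1 //.
  by rewrite nxT.1.
Qed.

Lemma embedding_agree (B : bigon) (D : finType) (r r' nx : D -> D) (f : B -> D) :
  embedding r nx f -> (forall y, r (f y) = r' (f y)) -> embedding r' nx f.
Proof. by move=> [fI fr fn] h; split=> // x; rewrite fr h. Qed.

(** * From a ladder to a maximal tentacle containing it *)

Lemma maximal_tentacle_exists (D : finType) (r nx : D -> D) (B : bigon) (f : B -> D) :
  tentacle B -> embedding r nx f ->
  exists (B' : bigon) (f' : B' -> D), maximal_tentacle r nx f' /\ sub_copy f f'.
Proof.
move=> tB eB.
(* A proper enlargement increases this size, which is at most twice [#|D|]; the induction is on the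
   remaining margin. *)
pose size_of (B' : bigon) (f' : B' -> D) := #|edge_darts f'| + #|face_darts f'|.
have hmax n : forall (B : bigon) (f : B -> D), tentacle B -> embedding r nx f ->
    #|D| + #|D| <= size_of B f + n ->
    exists (B' : bigon) (f' : B' -> D), maximal_tentacle r nx f' /\ sub_copy f f'.
  elim: n => [|n IH] {}B {}f {}tB {}eB hn.
    exists B, f; split; last by split.
    split=> // B' f' _ _ [s1 s2].
    have c1 : #|edge_darts f'| <= #|D| := max_card _.
    have c2 : #|face_darts f'| <= #|D| := max_card _.
    have c3 := subset_leq_card s1; have c4 := subset_leq_card s2.
    rewrite /size_of in hn; rewrite /sub_copy.
    have /eqP <- : edge_darts f == edge_darts f' by rewrite eqEcard s1; lia.
    have /eqP <- : face_darts f == face_darts f' by rewrite eqEcard s2; lia.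
    by split.
  case: (pselect (exists (B' : bigon) (f' : B' -> D),
    [/\ tentacle B', embedding r nx f', sub_copy f f' & size_of B f < size_of B' f'])).
    move=> [B' [f' [tB' eB' sB' lB']]].
    have [B2 [f2 [m2 s2]]] := IH B' f' tB' eB' ltac:(lia).
    exists B2, f2; split=> //; case: sB' s2 => s1 s2 [s3 s4].
    by split; [exact: subset_trans s1 s3 | exact: subset_trans s2 s4].
  move=> hB; exists B, f; split; last by split.
  split=> // B' f' tB' eB' [s1 s2].
  have c3 := subset_leq_card s1; have c4 := subset_leq_card s2.
  have hle : size_of B' f' <= size_of B f.
    by rewrite leqNgt; apply/negP => h; apply: hB; exists B', f'.
  rewrite /size_of in hle; rewrite /sub_copy.
  have /eqP <- : edge_darts f == edge_darts f' by rewrite eqEcard s1; lia.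
  have /eqP <- : face_darts f == face_darts f' by rewrite eqEcard s2; lia.
  by split.
exact: (hmax (#|D| + #|D|) B f tB eB (leq_addl _ _)).
Qed.

(** The embedding is [f] followed by the inverse of [f']. Inclusion of the face darts ensures that
    inner darts go to inner darts, where [f'] commutes with [next]. *)
Lemma sub_copy_embedding (D : finType) (r nx : D -> D) (B B' : bigon)
    (f : B -> D) (f' : B' -> D) :
  embedding r nx f -> embedding r nx f' -> sub_copy f f' ->
  exists h : B -> B', embedding (@brev B') (@bnext B') h.
Proof.
move=> [fI fr fn] [f'I f'r f'n] [/fintype.subsetP s1 /fintype.subsetP s2].
have hx x : exists y, f x = f' y.
  have /imsetP[y _ e] : f x \in edge_darts f' by apply/s1/imsetP; exists x.
  by exists y.
have [h hh] := choice hx.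
exists h; split.
- by move=> x y e; apply: fI; rewrite !hh e.
- by move=> x; apply/f'I; rewrite -hh fr f'r -hh.
- move=> x xi; apply/f'I; rewrite -hh fn //.
  have /imsetP[y yi e] : f x \in face_darts f' by apply/s2/imsetP; exists x.
  by move: (hh x); rewrite e => /f'I <-; rewrite f'n.
Qed.

Lemma ladder_has_maximal l n (m : labelled_map n) (f : ladder l -> 'I_(6 * n)) :
  embedding (lrev m) (lnext m) f -> has_maximal_tentacle_with_ladder l m.
Proof.
move=> fE; have [tB _] := ladder_tentacle l.-1.
have [B' [f' [[tB' fE' mB'] sB]]] := maximal_tentacle_exists tB fE.
exists B', f'; split; first by split.
exact: sub_copy_embedding fE fE' sB.
Qed.

(** * Marked ladders grown from gluings without ladder *)

Section Growth.

Variables (D : finType) (nx : {perm D}) (V l : nat).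
Hypothesis nxT : triangular nx.

Definition gluing (r : {perm D}) :=
  [/\ matching r, joined r nx & #|porbits (r * nx)| = V].

(** Here [l] counts insertions: [ladder_rec l] is the ladder $B_{l+1}$. *)
Definition no_ladder (r : {perm D}) :=
  gluing r /\ ~ exists f : projT1 (ladder_rec l) -> D, embedding r nx f.

(* The mark [p.2] is the end of the ladder, where the next insertion is made. *)
Definition grown k : {set {perm D} * D} := [set p | `[< [/\ gluing p.1,
  exists2 f, embedding p.1 nx f & f (projT2 (ladder_rec k)) = p.2 &
  exists2 r, no_ladder r & #|[set z | p.1 z != r z]| <= 16 * k] >]].

Lemma card_grown0 :
  #|[set r | `[< no_ladder r >]]| * #|D| <= #|grown 0|.
Proof.
rewrite -(cardsT D) -cardsX; apply/subset_leq_card/fintype.subsetP => -[r x].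
rewrite !inE andbT /= => /asboolP rB; apply/asboolP; split => /=.
- by case: rB.
- case: rB => -[rM _ _] _.
  exists (fun b : bool => if b then x else r x) => //; split => /=.
  + by case=> -[] // e; case: (rM.2 x).
  + by case; rewrite ?rM.1.
  (* Both darts of a single edge are outer, so there is no face to preserve. *)
  + move=> y; rewrite !inE; case/negP.
    by case: y; [exact: connect0 | exact: (fconnect1 negb true)].
- exists r => //; rewrite (_ : [set _ | _] = finset.set0) ?cards0 //.
  by apply/setP => z; rewrite !inE eqxx.
Qed.

Lemma grown_transplant k r x d f : (r, x) \in grown k -> embedding r nx f ->
  f (projT2 (ladder_rec k)) = x -> forall K, cheap nx K r d ->
  (forall y, ~~ two_faces nx r d (f y)) ->
  (transplant nx r d x, nx (r d)) \in grown k.+1.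
Proof.
rewrite inE => /asboolP[/= [rM rJ rV] _ [r0 r0B hr0]] fE fx K dC fN.
have dR := cheap_removable dC.
have rfx : r x = f (brev (projT2 (ladder_rec k))) by case: fE => _ -> _; rewrite fx.
have xN : ~~ two_faces nx r d x by rewrite -fx.
have rxN : ~~ two_faces nx r d (r x) by rewrite rfx.
rewrite inE; apply/asboolP; split=> /=.
- split; first exact: transplant_matching.
  + exact: transplant_joined.
  + by rewrite transplant_porbits.
- have := @embedding_transplant _ (projT2 (ladder_rec k)) _ _ _ _ _ nxT rM rJ dR
    (fun y => (ladder_matching y).1) (fun y => (ladder_matching y).2) fE fN.
  rewrite fx; move: f fE fx fN {rfx}; case: (ladder_rec k) => B b /= f fE fx fN E.
  by eexists; [exact: E | rewrite /= expg1].
- exists r0 => //; have c := card_transplant_neq nxT rM rJ dC xN rxN.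
  apply: leq_trans (_ : 16 + 16 * k <= _); last by lia.
  apply: leq_trans (leq_add c hr0); apply: leq_trans (leq_card_setU _ _).
  apply/subset_leq_card/fintype.subsetP => z; rewrite !inE.
  by apply: contraR; rewrite negb_or !negbK => /andP[/eqP-> /eqP->].
Qed.

End Growth.

(** * Growing ladders *)

Lemma card_set_pair (T1 T2 : finType) (P : pred T1) (Q : T1 -> pred T2) :
  #|[set t : T1 * T2 | P t.1 & Q t.1 t.2]| = \sum_(p | P p) #|[set d | Q p d]|.
Proof.
rewrite (eq_bigr (fun p => \sum_(d | Q p d) 1)) => [|p _]; last first.
  by rewrite -sum1_card; apply: eq_bigl => d; rewrite inE.
rewrite pair_big_dep /= -sum1_card; apply: eq_bigl => t.
by rewrite inE.
Qed.

Section GrowthBounds.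

Variables (D : finType) (nx : {perm D}) (V l : nat).
Hypothesis nxT : triangular nx.

Local Notation grown := (grown nx V l).

(** Double counting of the pairs formed by a grown ladder and a dart to transplant: a positive
    fraction of [#|D|] choices going forward, at most [#|D| * (12 * M).+1] going back, so that
    [#|D|] cancels. *)
Lemma card_grown_step M k : 1 < V -> 0 < #|D| -> #|D| <= 6 * M * V ->
  432 * M * (6 * k + 2) <= #|D| ->
  #|grown k| <= 72 * M * (12 * M).+1 * #|grown k.+1|.
Proof.
move=> V2 D0 DV Dk.
pose Q (p : {perm D} * D) d := cheap nx (12 * M) p.1 d &&
  `[< exists2 f : projT1 (ladder_rec k) -> D, embedding p.1 nx f /\
      f (projT2 (ladder_rec k)) = p.2 & forall y, ~~ two_faces nx p.1 d (f y) >].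
pose Aset := [set t : {perm D} * D * D | t.1 \in grown k & Q t.1 t.2].
have lower : #|grown k| * #|D| <= 72 * M * #|Aset|.
  rewrite /Aset card_set_pair big_distrr /= -sum_nat_const.
  apply: leq_sum => -[r x]; rewrite inE => /asboolP[/= [rM rJ rV] [f fE fx] _].
  have Lle : #|[set f y | y : projT1 (ladder_rec k)]| <= 6 * k + 2.
    by rewrite -card_ladder; apply: leq_imset_card.
  have := card_cheap_avoiding nxT rM rJ _ _ Lle Dk; rewrite rV => /(_ V2 DV) h.
  apply: leq_trans h _; rewrite leq_mul2l; apply/orP; right.
  apply/subset_leq_card/fintype.subsetP => d; rewrite !inE /Q /=.
  case/andP => -> /forall_inP hL /=; apply/asboolP; exists f => // y.
  by apply: hL; apply/imsetP; exists y.
have upper : #|Aset| <= #|grown k.+1| * (#|D| * (12 * M).+1).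
  pose g (t : ({perm D} * D) * (D * option 'I_(12 * M))) :=
    untransplant nx t.1.1 t.1.2 t.2.1 t.2.2.
  have <- : #|[set: D * option 'I_(12 * M)]| = #|D| * (12 * M).+1.
    by rewrite cardsT card_prod card_option card_ord.
  rewrite -cardsX; apply: leq_trans (leq_imset_card g _).
  apply/subset_leq_card/fintype.subsetP => -[[r x] d].
  rewrite inE /= => /andP[rx /andP[/= dC /asboolP[f [fE fx] fN]]].
  have := rx; rewrite inE => /asboolP[/= [rM rJ rV] _ _].
  have rfx : r x = f (brev (projT2 (ladder_rec k))) by case: fE => _ -> _; rewrite fx.
  have xN : ~~ two_faces nx r d x by rewrite -fx.
  have rxN : ~~ two_faces nx r d (r x) by rewrite rfx.
  have [al [oj e]] := untransplantK nxT rM rJ dC xN rxN.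
  apply/imsetP; exists ((transplant nx r d x, nx (r d)), (al, oj)); last by rewrite /g /= e.
  rewrite !inE andbT; have := grown_transplant nxT rx fE fx dC fN.
  by rewrite inE.
rewrite -(leq_pmul2r D0); apply: leq_trans lower _.
by rewrite -!mulnA !leq_mul2l; apply/orP; right; apply/orP; right;
  rewrite mulnCA [_ * #|D|]mulnC mulnCA [X in _ <= X]mulnCA; rewrite mulnC in upper *; lia.
Qed.

(** For a fixed gluing, a ladder must meet the at most [16 * l] darts where it differs from a gluing
    without ladder. By [ladder_embedding_eq] the ladder, hence its mark, is determined by one such
    dart and its position among the [6 * l + 2] darts of the ladder. *)
Lemma card_grown_le :
  #|grown l| <= #|[set r | `[< gluing nx V r >]]| * ((6 * l + 2) * (16 * l)).
Proof.
set S := [set r | _].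
have -> : #|grown l| = \sum_(r in S) #|[set x | (r, x) \in grown l]|.
  rewrite -(card_set_pair (mem S) (fun r x => (r, x) \in grown l)).
  apply: eq_card => -[r x]; rewrite [in RHS]inE /= andb_idl //.
  by rewrite !inE => /asboolP[h _ _]; apply/asboolP.
rewrite -sum_nat_const.
apply: leq_sum => r _.
have [->|[x0]] := set_0Vmem [set x | (r, x) \in grown l]; first by rewrite cards0.
(* The gluing [r0] coming from the single mark [x0] serves for all marks of [r], since only the
   absence of ladders in [r0] matters. *)
rewrite !inE => /asboolP[/= rG _ [r0 r0B W16]].
set W := [set z | r z != r0 z] in W16.
pose L := projT1 (ladder_rec l).
pose G (t : L * D) := odflt x0 [pick x | `[< exists2 f : L -> D, embedding r nx f &
  f t.1 = t.2 /\ f (projT2 (ladder_rec l)) = x >]].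
apply: (@leq_trans #|G @: finset.setX [set: L] W|).
  apply/subset_leq_card/fintype.subsetP => x; rewrite !inE.
  move=> /asboolP[/= _ [f fE fx] _].
  have [y yW] : exists y, f y \in W.
    apply: contrapT => h; case: r0B => _; apply; exists f.
    apply: embedding_agree fE _ => y; apply/eqP/negPn/negP => e.
    by apply: h; exists y; rewrite inE.
  apply/imsetP; exists (y, f y); first by rewrite !inE in yW *.
  rewrite /G; case: pickP => [x' /asboolP[f' f'E [/= f'y f'x]]|/(_ x)].
    by rewrite /= -fx -f'x; apply: ladder_embedding_eq fE f'E (esym f'y) _.
  by move/asboolP; case; exists f.
apply: leq_trans (leq_imset_card _ _) _.
by rewrite cardsX cardsT card_ladder leq_mul2l W16 orbT.
Qed.

Lemma card_no_ladder_le M : 1 < V -> 0 < #|D| -> #|D| <= 6 * M * V ->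
  432 * M * (6 * l + 2) <= #|D| ->
  #|[set r | `[< no_ladder nx V l r >]]| * #|D| <=
  (72 * M * (12 * M).+1) ^ l * (#|[set r | `[< gluing nx V r >]]| * ((6 * l + 2) * (16 * l))).
Proof.
move=> V2 D0 DV Dl; set q := 72 * M * _.
have h k : k <= l -> #|grown 0| <= q ^ k * #|grown k|.
  elim: k => [|k IH] kl; first by rewrite expn0 mul1n.
  apply: leq_trans (IH (ltnW kl)) _; rewrite expnSr -mulnA leq_mul2l.
  rewrite card_grown_step ?orbT //; apply: leq_trans Dl.
  by rewrite leq_mul2l leq_add2r leq_mul2l (ltnW kl) !orbT.
apply: leq_trans (card_grown0 nx V l) _.
apply: leq_trans (h l (leqnn _)) _.
by rewrite leq_mul2l card_grown_le orbT.
Qed.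

End GrowthBounds.

(** * Labelled and unlabelled triangulations *)

Section MapConditions.

Variable (D : finType).
Implicit Types (p r nx s : {perm D}).

Lemma matchingE r : [forall A in porbits r, #|A| == 2] <-> matching r.
Proof.
split=> [/forall_inP h|[rK rN]].
  have h2 x : #|porbit r x| = 2 by apply/eqP/h/imset_f.
  split=> x; first by have := iter_porbit r x; rewrite h2.
  by have := uniq_traject_porbit r x; rewrite h2 /= inE andbT => /eqP e1 /esym.
apply/forall_inP => _ /imsetP[x _ ->].
suff -> : porbit r x = [set x; r x] by rewrite cards2; have /eqP/negbTE := rN x; rewrite eq_sym => ->.
apply/setP => y; apply/idP/idP; last first.
  by rewrite !inE => /orP[/eqP ->|/eqP ->]; [exact: porbit_id|exact: porbit_step].
have inv : invariant_under r (fun z => z \in [set x; r x]).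
  by apply: stable_invariant => z; rewrite !inE => /orP[] /eqP ->; rewrite ?rK eqxx ?orbT.
by move/(porbit_invariant inv) ->; rewrite !inE eqxx.
Qed.

Lemma triangularE nx : [forall A in porbits nx, #|A| == 3] <-> triangular nx.
Proof.
split=> [/forall_inP h|[n3 nN]].
  have h3 x : #|porbit nx x| = 3 by apply/eqP/h/imset_f.
  split=> x; first by have := iter_porbit nx x; rewrite h3.
  have := uniq_traject_porbit nx x; rewrite h3 /= !inE negb_or -andbA.
  by case/and3P => /eqP e1 _ _ /esym.
apply/forall_inP => _ /imsetP[x _ ->].
suff -> : porbit nx x = [set x; nx x; nx (nx x)].
  have e1 := nN x; have e2 := nN (nx x); have e3 := n3 x.
  rewrite setUC cardsU1 cards2 !inE negb_or.
  by rewrite !neq_ft //; congruence.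
apply/setP => y; apply/idP/idP; last first.
  rewrite !inE -orbA => /or3P[] /eqP ->; first exact: porbit_id.
    exact: porbit_step.
  by apply: porbit_trans (porbit_step (y := nx x) _) => //; apply: porbit_step.
have inv : invariant_under nx (fun z => z \in [set x; nx x; nx (nx x)]).
  apply: stable_invariant => z; rewrite !inE -!orbA.
  by case/or3P => /eqP ->; rewrite ?n3 eqxx ?orbT.
by move/(porbit_invariant inv) ->; rewrite !inE eqxx.
Qed.

Lemma joinedE r nx (x0 : D) :
  [transitive <<[set r; nx]>>%g, on [set: D] | 'P] <-> joined r nx.
Proof.
set G := <<_>>%g.
have rG : r \in G by rewrite mem_gen // !inE eqxx.
have nG : nx \in G by rewrite mem_gen // !inE eqxx orbT.
split=> [tr S hr hn u v|rJ].
  have [a aG ->] := atransP2 tr (in_setT v) (in_setT u).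
  suff : a \in 'N([set z | S z] | 'P)%g.
    by move/astabsP => /(_ v); rewrite !inE.
  apply: (fintype.subsetP _ a aG); rewrite gen_subG.
  by apply/fintype.subsetP => b /set2P[] ->;
    apply/astabsP => z; rewrite !inE /= ?hr ?hn.
apply/imsetP; exists x0 => //; apply/esym/setP => y; rewrite in_setT.
have := rJ (fun z => z \in orbit 'P%act G x0) _ _ y x0; rewrite orbit_refl; apply.
- by move=> z; rewrite -[r z]/('P%act z r) orbit_actr.
- by move=> z; rewrite -[nx z]/('P%act z nx) orbit_actr.
Qed.

End MapConditions.

Lemma card_porbits_conj (D D' : finType) (h : D -> D') (p : {perm D}) (p' : {perm D'}) :
  bijective h -> (forall x, p' (h x) = h (p x)) -> #|porbits p'| = #|porbits p|.
Proof.
move=> [h' hK h'K] hp; have hi : injective h by apply: can_inj hK.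
have hpi x i : h ((p ^+ i)%g x) = (p' ^+ i)%g (h x).
  by elim: i => [|i IH]; rewrite ?expg0 ?perm1 // !expgSr !permM -hp IH.
have e x : porbit p' (h x) = h @: porbit p x.
  apply/setP => y; apply/porbitP/imsetP => [[i ->]|[z /porbitP[i ->] ->]].
    by exists ((p ^+ i)%g x); [exact: mem_porbit | rewrite hpi].
  by exists i; rewrite hpi.
have -> : porbits p' = [set h @: A | A : {set D} in porbits p].
  apply/setP => A; apply/imsetP/imsetP => [[x _ ->]|[_ /imsetP[x _ ->] ->]].
    by exists (porbit p (h' x)); [exact: imset_f | rewrite -e h'K].
  by exists (h x); rewrite // e.
by rewrite card_imset //; apply: imset_inj.
Qed.

Section LabelledMaps.

Variables (n g V : nat).
Hypothesis VE : V + 2 * g = n + 2.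

Implicit Types (m : labelled_map n) (s : 'S_(6 * n)).

(** With 3n edges and 2n faces, Euler's formula becomes V + 2g = n + 2. *)
Lemma is_triangulationP m :
  is_triangulation g m <-> triangular (lnext m) /\ gluing (lnext m) V (lrev m).
Proof.
have cD : #|[set: 'I_(6 * n)]| = 6 * n by rewrite cardsT card_ord.
have cardE : [forall A in edges m, #|A| == 2] -> #|edges m| * 2 = 6 * n.
  move/forall_inP => h; rewrite -[RHS]cD.
  apply/esym/card_uniform_partition; last exact: porbits_partition.
  by move=> A /h /eqP.
have cardF : [forall A in faces m, #|A| == 3] -> #|faces m| * 3 = 6 * n.
  move/forall_inP => h; rewrite -[RHS]cD.
  apply/esym/card_uniform_partition; last exact: porbits_partition.
  by move=> A /h /eqP.
split.
  case/and4P => h1 h2 h3 /eqP h4; have := cardE h1; have := cardF h2 => e1 e2.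
  split; first exact/triangularE; split; first exact/matchingE.
    exact/(joinedE _ _ (lroot m)).
  rewrite -/(vertices m); lia.
case=> /triangularE h2 [/matchingE h1 /(joinedE _ _ (lroot m)) h3 h4].
apply/and4P; split => //.
have := cardE h1; have := cardF h2 => e1 e2.
by rewrite -/(vertices m) in h4; apply/eqP; lia.
Qed.

Definition relabel m s : labelled_map n :=
  ((lrev m ^ s)%g, (lnext m ^ s)%g, s (lroot m)).

Lemma rooted_isoP m m' : reflect (exists s, m' = relabel m s) (rooted_iso m m').
Proof.
apply: (iffP existsP) => -[s]; last first.
  move=> ->; exists s; apply/and3P; split; rewrite ?eqxx //;
    by apply/forallP => x; rewrite permJ.
case/and3P => /forallP h1 /forallP h2 /eqP h3; exists s.
case: m' h1 h2 h3 => -[r' nx'] x' /= h1 h2 h3; rewrite /relabel h3; congr (_, _, _).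
  by apply/permP => x; rewrite -[x](permKV s) permJ; apply/esym/eqP/h1.
by apply/permP => x; rewrite -[x](permKV s) permJ; apply/esym/eqP/h2.
Qed.

Lemma relabel1 m : relabel m 1 = m.
Proof. by case: m => -[r nx] x; rewrite /relabel !conjg1 perm1. Qed.

Lemma relabelM m s t : relabel (relabel m s) t = relabel m (s * t).
Proof. by rewrite /relabel /lrev /lnext /lroot /= !conjgM permM. Qed.

Lemma rooted_iso_equivalence : equivalence_rel (@rooted_iso n).
Proof.
move=> m m' m''; split; first by apply/rooted_isoP; exists 1%g; rewrite relabel1.
move=> /rooted_isoP[s ->]; apply/rooted_isoP/rooted_isoP => -[t ->].
  by exists (s^-1 * t)%g; rewrite relabelM mulKVg.
by exists (s * t)%g; rewrite relabelM.
Qed.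

Lemma relabel_triangulation m s : is_triangulation g m -> is_triangulation g (relabel m s).
Proof.
move/is_triangulationP => [[n3 nN] [[rK rN] rJ rV]].
have J (p : 'S_(6 * n)) z : (p ^ s)%g z = s (p ((s^-1)%g z)).
  by rewrite -{1}[z](permKV s) permJ.
apply/is_triangulationP; split; [split => z | split; [split => z | | ]].
- by rewrite /relabel /lnext /= !J !permK n3 permKV.
- rewrite /relabel /lnext /= J => e; case: (nN ((s^-1)%g z)).
  by apply: (@perm_inj _ s); rewrite e permKV.
- by rewrite /relabel /lrev /= !J !permK rK permKV.
- rewrite /relabel /lrev /= J => e; case: (rN ((s^-1)%g z)).
  by apply: (@perm_inj _ s); rewrite e permKV.
- move=> S hr hn u v.
  have := rJ (fun z => S (s z)) _ _ ((s^-1)%g u) ((s^-1)%g v); rewrite !permKV.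
  apply=> z; first by rewrite -(hr (s z)) permJ.
  by rewrite -(hn (s z)) permJ.
- rewrite -conjMg -rV; apply: (card_porbits_conj (h := s)) => [|x].
    by exists (s^-1)%g; [exact: permK | exact: permKV].
  exact: permJ.
Qed.

(* A relabelling fixing a connected rooted map is trivial. *)
Lemma relabel_inj m : is_triangulation g m -> injective (relabel m).
Proof.
move/is_triangulationP => [_ [_ rJ _]] s t; rewrite /relabel => -[e1 e2 e3].
apply/permP => z; apply/eqP.
rewrite -[_ == _]/((fun z => s z == t z) z) (rJ _ _ _ z (lroot m)) ?e3 ?eqxx //;
  apply: stable_invariant => y /eqP e.
- by rewrite -permJ e e1 permJ.
- by rewrite -permJ e e2 permJ.
Qed.

Lemma triangulations_partition :
  finset.partition (triangulations n g) [set m | is_triangulation g m].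
Proof.
by apply: equivalence_partitionP => m m' m'' _ _ _; apply: rooted_iso_equivalence.
Qed.

(** A class is an orbit of the relabelling action, which is free by [relabel_inj]. *)
Lemma card_triangulation_class c : c \in triangulations n g -> #|c| = (6 * n)`!.
Proof.
case/imsetP => m; rewrite inE => mT ->.
have -> : [set m' in [set m | is_triangulation g m] | rooted_iso m m'] =
    relabel m @: [set: 'S_(6 * n)].
  apply/setP => m'; rewrite !inE; apply/andP/imsetP => [[_ /rooted_isoP[s ->]]|[s _ ->]].
    by exists s.
  by split; [exact: relabel_triangulation | apply/rooted_isoP; exists s].
by rewrite card_imset ?cardsT ?card_Sn //; apply: relabel_inj.
Qed.

End LabelledMaps.

Lemma card_set_fibers (T1 T2 T3 : finType) (S : {set T1 * T2 * T3}) :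
  #|S| = \sum_(t : T2 * T3) #|[set a | (a, t.1, t.2) \in S]|.
Proof.
rewrite (eq_bigr (fun t => \sum_(a | (a, t.1, t.2) \in S) 1)) => [|t _]; last first.
  by rewrite -sum1_card; apply: eq_bigl => a; rewrite inE.
rewrite pair_big_dep /= -sum1_card.
rewrite (reindex (fun u : T2 * T3 * T1 => (u.2, u.1.1, u.1.2))) /=; last first.
  by exists (fun m : T1 * T2 * T3 => (m.1.2, m.2, m.1.1)) => -[[? ?] ?].
by apply: eq_bigl => -[[? ?] ?].
Qed.

Section BadTriangulations.

Variables (n g V l M : nat).
Hypotheses (VE : V + 2 * g = n + 2) (V2 : 1 < V) (n0 : 0 < n) (nMV : n <= M * V).
Hypothesis nl : 72 * M * (6 * l.-1 + 2) <= n.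

Let k := l.-1.

Definition ladder_free : {set labelled_map n} :=
  [set m | is_triangulation g m & `[< ~ exists f : projT1 (ladder_rec k) -> 'I_(6 * n),
    embedding (lrev m) (lnext m) f >]].

Let q := (72 * M * (12 * M).+1) ^ k * ((6 * k + 2) * (16 * k)).

(** The bound is summed over the pairs of a face permutation and a root, both left unchanged by the
    surgery. *)
Lemma card_ladder_free :
  #|ladder_free| * (6 * n) <= q * #|[set m : labelled_map n | is_triangulation g m]|.
Proof.
rewrite (card_set_fibers ladder_free) (card_set_fibers [set m | _]).
rewrite big_distrl big_distrr /=; apply: leq_sum => -[nx x] _ /=.
have [nxT|nxN] := pselect (triangular nx); last first.
  rewrite (_ : [set a | _] = finset.set0) ?cards0 //; apply/setP => r; rewrite !inE.
  by apply/negP => /andP[/(is_triangulationP VE) [/= h _]].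
have cD : #|'I_(6 * n)| = 6 * n by rewrite card_ord.
have c1 : 0 < #|'I_(6 * n)| by rewrite cD muln_gt0.
have c2 : #|'I_(6 * n)| <= 6 * M * V by rewrite cD -mulnA leq_mul2l nMV orbT.
have c3 : 432 * M * (6 * k + 2) <= #|'I_(6 * n)|.
  by rewrite cD (_ : 432 = 6 * 72) // -!mulnA leq_mul2l /= mulnA.
have := card_no_ladder_le nxT V2 c1 c2 c3; rewrite cD => h.
set A := [set r | `[< no_ladder _ _ _ _ >]] in h.
set B := [set r | `[< gluing _ _ _ >]] in h.
have sA : #|[set r | (r, nx, x) \in ladder_free]| <= #|A|.
  apply/subset_leq_card/fintype.subsetP => r; rewrite !inE.
  move=> /andP[/(is_triangulationP VE) [_ rG] /asboolP rN].
  by apply/asboolP.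
have sB : #|B| <= #|[set r | (r, nx, x) \in [set m : labelled_map n | is_triangulation g m]]|.
  apply/subset_leq_card/fintype.subsetP => r; rewrite !inE => /asboolP rG.
  exact/(is_triangulationP VE).
apply: (@leq_trans (#|A| * (6 * n))); first by rewrite leq_mul2r sA orbT.
apply: leq_trans h _; rewrite /q -[leqRHS]mulnA leq_mul2l; apply/orP; right.
by rewrite mulnC leq_mul2l sB orbT.
Qed.

Definition good_classes := [set c in triangulations n g |
  `[< exists2 m, m \in c & has_maximal_tentacle_with_ladder l m >]].

(** A bad class contains only ladder-free labelled maps, and all classes have the same size, so the
    labelled bound passes to classes. *)
Lemma card_bad_classes :
  (#|triangulations n g| - #|good_classes|) * (6 * n) <= q * #|triangulations n g|.
Proof.
have gsub : good_classes \subset triangulations n g.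
  by apply/fintype.subsetP => c; rewrite inE => /andP[].
rewrite -(cardsDS gsub); set bad := _ :\: _.
have badsub : bad \subset triangulations n g by apply: subsetDl.
have part := triangulations_partition n g.
have cT := card_uniform_partition (fun c => @card_triangulation_class n g V VE c) part.
have cB : #|bad| * (6 * n)`! <= #|ladder_free|.
  have := part => /and3P[_ tI _]; have /eqnP := trivIsetS badsub tI.
  rewrite (eq_bigr (fun=> (6 * n)`!)) => [|c /(fintype.subsetP badsub)]; last first.
    exact: (card_triangulation_class VE).
  rewrite sum_nat_const => ->; apply/subset_leq_card/bigcupsP => c cb.
  apply/fintype.subsetP => m mc.
  have cc := fintype.subsetP badsub _ cb.
  have : m \in cover (triangulations n g) by apply/bigcupP; exists c.
  rewrite (cover_partition part) !inE => -> /=; apply/asboolP => -[f fE].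
  move: cb; rewrite !inE cc andbT => /asboolP; apply; exists m => //.
  exact: ladder_has_maximal fE.
rewrite -(leq_pmul2r (fact_gt0 (6 * n))) -[leqRHS]mulnA -cT.
apply: leq_trans card_ladder_free; rewrite mulnAC leq_mul2r.
by rewrite cB orbT.
Qed.

End BadTriangulations.

(** * Existence of triangulations *)

Section Construction.

Variable n : nat.

(* [n.+1] spheres made of two triangles each, where the sides
   [(i, true, 0)] and [(i, false, 0)] are glued together. *)
Local Notation dart := ('I_n.+1 * bool * 'Z_3)%type.

Let next_fun (x : dart) : dart := (x.1, x.2 + 1)%R.
Let rev_fun (x : dart) : dart := (x.1.1, ~~ x.1.2, - x.2)%R.

Let next_inj : injective next_fun.
Proof.
move=> x y e; rewrite [x]surjective_pairing [y]surjective_pairing.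
have /= -> := congr1 fst e.
by rewrite (GRing.addIr 1%R (congr1 snd e : x.2 + 1 = y.2 + 1)%R).
Qed.

Let rev_inv : involutive rev_fun.
Proof. by move=> [[i s] j]; rewrite /rev_fun /= negbK GRing.opprK. Qed.

Let nx := perm next_inj.
Let r0 := perm (inv_inj rev_inv).

Let nxE i s j : nx (i, s, j) = (i, s, j + 1)%R. Proof. exact: permE. Qed.
Let r0E i s j : r0 (i, s, j) = (i, ~~ s, - j)%R. Proof. exact: permE. Qed.

Let Z3_12 : (1 + 1 : 'Z_3)%R = 2%R. Proof. by []. Qed.
Let Z3_01 : (0 + 1 : 'Z_3)%R = 1%R. Proof. exact: val_inj. Qed.
Let Z3_20 : (2 + 1 : 'Z_3)%R = 0%R. Proof. exact: val_inj. Qed.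
Let Z3_N1 : (- 1 : 'Z_3)%R = 2%R. Proof. exact: val_inj. Qed.
Let Z3_N2 : (- 2 : 'Z_3)%R = 1%R. Proof. exact: val_inj. Qed.

Let nxT : triangular nx.
Proof.
split=> -[[i s] j]; rewrite !nxE.
  by case: (Z3_cases j) => ->; rewrite ?Z3_01 ?Z3_12 ?Z3_20 ?Z3_01 ?Z3_12.
by case: (Z3_cases j) => ->; case.
Qed.

Let r0M : matching r0.
Proof.
split=> -[[i s] j]; rewrite !r0E ?negbK ?GRing.opprK //.
by case; case: s.
Qed.

Let card_r0 : #|porbits (r0 * nx)| = 3 * n.+1.
Proof.
(* Each sphere has three vertices of degree 2, so the vertex permutation is itself a matching. *)
have M : matching (r0 * nx)%g.
  split=> -[[i s] j]; rewrite !permM !r0E !nxE ?r0E ?nxE; last by case; case: s.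
  by rewrite negbK GRing.opprD GRing.opprK GRing.addrNK.
have /forall_inP h := (matchingE _).2 M.
have := card_uniform_partition (fun A hA => eqP (h A hA)) (porbits_partition (r0 * nx)%g).
rewrite cardsT !card_prod !card_ord card_bool /Zp_trunc /= => e.
by apply/eqP; rewrite -(eqn_pmul2r (isT : 0 < 2)) -[X in X == _]e; apply/eqP; lia.
Qed.

(* The spheres [0], ..., [k] are opened and glued in a cycle. *)
Let chain k : k <= n -> exists r : {perm dart}, [/\ matching r,
  #|porbits (r * nx)| + 2 * k = 3 * n.+1,
  forall i s j, j != 0%R -> r (i, s, j) = (i, ~~ s, - j)%R &
  forall i : 'I_n.+1, r (i, true, 0%R) =
    (if i < k then inord i.+1 else if i == k :> nat then ord0 else i, false, 0%R)].
Proof.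
elim: k => [_|k IH kn].
  exists r0; split=> //; rewrite ?card_r0 ?muln0 ?addn0 //.
  move=> i; rewrite r0E GRing.oppr0 ltn0; case: eqP => // e.
  by congr (_, _, _); apply: val_inj.
have [r [rM rV rj rd]] := IH (ltnW kn).
pose ik : 'I_n.+1 := inord k; pose il : 'I_n.+1 := inord k.+1.
have vk : ik = k :> nat by rewrite inordK // ltnW.
have vl : il = k.+1 :> nat by rewrite inordK.
have kl : ik <> il by move=> e; move: vl; rewrite -e vk => /eqP; rewrite ltn_eqF.
have ra : r (ik, true, 0%R) = (ord0, false, 0%R) by rewrite rd vk ltnn eqxx.
have rb' : r (il, true, 0%R) = (il, false, 0%R).
  by rewrite rd vl ltnNge leqnSn /= gtn_eqF.
have rb : r (il, false, 0%R) = (il, true, 0%R) by rewrite -rb' rM.1.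
have l0 : il <> ord0 by move=> e; move: vl; rewrite e.
have ab : (ik, true, 0%R) <> (il, false, 0%R) :> dart by [].
exists (switch r (ik, true, 0%R) (il, false, 0%R)); split.
- exact: switch_matching.
- rewrite -rV mulnS addnA; congr (_ + _).
  (* Both ends of the opened edge of the new sphere are merged with vertices of the chain. *)
  apply: (@switch_porbits_merge _ _ _ _ _
    (fun z => z \in [:: (il, true, 0%R); (il, false, 1%R)])
    (fun z => z \in [:: (il, false, 0%R); (il, true, 1%R)])).
  + apply: stable_invariant => z; rewrite !inE permM.
    by case/orP => /eqP ->; rewrite ?rb' ?rj // nxE ?Z3_N1 ?Z3_20 ?Z3_01 eqxx ?orbT.
  + apply: stable_invariant => z; rewrite !inE permM.
    by case/orP => /eqP ->; rewrite ?rb ?rj // nxE ?Z3_N1 ?Z3_20 ?Z3_01 eqxx ?orbT.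
  + by rewrite rb !inE eqxx.
  + by rewrite !inE !xpair_eqE (negbTE (neq_ft kl)).
  + by rewrite !inE eqxx.
  + by rewrite ra !inE !xpair_eqE eq_sym (negbTE (neq_ft l0)).
  + by rewrite !inE !xpair_eqE (negbTE (neq_ft kl)).
  + by rewrite rb !inE !xpair_eqE !eqxx.
- move=> i s j j0; rewrite switch_id ?rj //.
  + by case=> _ _ e; move: j0; rewrite e.
  + by case=> _ _ e; move: j0; rewrite e.
  + move=> e; have /eqP : (- j = 0)%R := congr1 snd e.
    by rewrite GRing.oppr_eq0 (negbTE j0).
  + move=> e; have /eqP : (- j = 0)%R := congr1 snd e.
    by rewrite GRing.oppr_eq0 (negbTE j0).
- move=> i; have [->|ik'] := eqVneq i ik.
    by rewrite switch_l // vk ltnSn.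
  have [->|il'] := eqVneq i il.
    by rewrite -rb switch_revr // vl ltnn eqxx ra.
  have ik2 : (i == k :> nat) = false.
    by apply: contraNF ik' => /eqP e; apply/eqP/val_inj; rewrite /= vk.
  have il2 : (i == k.+1 :> nat) = false.
    by apply: contraNF il' => /eqP e; apply/eqP/val_inj; rewrite /= vl.
  rewrite switch_id //.
  + by rewrite rd ltnS [i <= k]leq_eqVlt ik2 il2.
  + by case=> e; rewrite e eqxx in ik'.
  + by rewrite rd.
  + move=> e; have : (i, true, 0%R) = r (il, false, 0%R) by rewrite -e rM.1.
    by rewrite rb => -[e2]; rewrite e2 eqxx in il'.
Qed.

(* The vertices of degree 2 inside the spheres [2 t] and [2 t + 1] are merged
   with a third vertex. *)
Let handles t : 2 * t <= n.+1 -> exists r : {perm dart}, [/\ matching r,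
  #|porbits (r * nx)| + 2 * t = n.+1 + 2,
  forall i, r (i, true, 1%R) = (i, false, 2%R),
  (forall i : 'I_n.+1, 2 * t <= i -> r (i, true, 2%R) = (i, false, 1%R)) &
  forall i : 'I_n.+1, i < n -> r (i, true, 0%R) = (inord i.+1, false, 0%R)].
Proof.
elim: t => [_|t IH tn].
  have [r [rM rV rj rd]] := chain (leqnn n).
  exists r; split=> // [|i|i _|i iN]; first by lia.
  - by rewrite rj // Z3_N1.
  - by rewrite rj // Z3_N2.
  - by rewrite rd iN.
have [|r [rM rV r1 r2 rl]] := IH; first by lia.
pose ia : 'I_n.+1 := inord (2 * t); pose ib : 'I_n.+1 := inord (2 * t).+1.
have va : ia = 2 * t :> nat by rewrite inordK //; lia.
have vb : ib = (2 * t).+1 :> nat by rewrite inordK //; lia.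
have iab : ia <> ib by move=> e; move: vb; rewrite -e va => /eqP; rewrite ltn_eqF.
have ra : r (ia, true, 2%R) = (ia, false, 1%R) by apply: r2; rewrite va.
have rb : r (ib, true, 2%R) = (ib, false, 1%R) by apply: r2; rewrite vb.
have r1' i : r (i, false, 2%R) = (i, true, 1%R) by rewrite -r1 rM.1.
have ab : (ia, true, 2%R) <> (ib, true, 2%R) :> dart by case.
exists (switch r (ia, true, 2%R) (ib, true, 2%R)); split.
- exact: switch_matching.
- rewrite -rV mulnS addnA; congr (_ + _).
  apply: (@switch_porbits_merge _ _ _ _ _
    (fun z => z \notin [:: (ia, true, 2%R); (ia, false, 2%R)])
    (fun z => z \in [:: (ib, true, 2%R); (ib, false, 2%R)])).
  + have inv : invariant_under (r * nx)%g
        (fun z => z \in [:: (ia, true, 2%R); (ia, false, 2%R)]).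
      apply: stable_invariant => z; rewrite !inE permM.
      by case/orP => /eqP ->; rewrite ?ra ?r1' nxE ?Z3_12 eqxx ?orbT.
    by move=> z /=; rewrite inv.
  + apply: stable_invariant => z; rewrite !inE permM.
    by case/orP => /eqP ->; rewrite ?rb ?r1' nxE ?Z3_12 eqxx ?orbT.
  + by rewrite rb !inE !xpair_eqE /= !andbF.
  + by rewrite negbK !inE eqxx.
  + by rewrite !inE eqxx.
  + by rewrite ra !inE !xpair_eqE /= !andbF.
  + by rewrite !inE !xpair_eqE (negbTE (neq_ft iab)).
  + by rewrite rb !inE !xpair_eqE /= !andbF.
- by move=> i; rewrite switch_id ?r1.
- move=> i ti; rewrite switch_id ?r2 //; try lia.
  + by case=> e; move: ti; rewrite e va; lia.
  + by case=> e; move: ti; rewrite e vb; lia.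
- by move=> i iN; rewrite switch_id ?rl.
Qed.

(** The closed chain has [n.+3] vertices, which is genus 0, and each handle costs two vertices and
    uses two spheres. Connectedness comes from the edges never reopened: one inside each sphere, one
    from each sphere to the next. *)
Lemma gluing_exists g : 2 * g <= n.+1 -> exists r nx : {perm dart},
  triangular nx /\ gluing nx (n.+3 - 2 * g) r.
Proof.
move=> gn; have [r [rM rV r1 _ rl]] := handles gn.
exists r, nx; split=> //; split=> //; last by lia.
move=> S hr hn.
have h0 i s j : S (i, s, j) = S (i, s, 0%R).
  have e0 := hn (i, s, 0%R); have e1 := hn (i, s, 1%R).
  rewrite !nxE Z3_01 Z3_12 in e0 e1.
  by case: (Z3_cases j) => ->; rewrite ?Z3_12 ?e1 ?e0.
have h1 i s : S (i, s, 0%R) = S (i, true, 0%R).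
  by case: s => //; rewrite -(h0 i false 2%R) -(h0 i true 1%R) -[RHS]hr r1.
have h2 i : S (i, true, 0%R) = S (ord0, true, 0%R).
  case: i => i; elim: i => [|i IH] iN; first by congr (S (_, _, _)); apply: val_inj.
  rewrite -(IH (ltnW iN)) -[RHS]hr rl // h1.
  by congr (S (_, _, _)); apply: val_inj; rewrite /= inordK.
by move=> [[i s] j] [[i' s'] j']; rewrite h0 h1 h2 [RHS]h0 [RHS]h1 [RHS]h2.
Qed.

End Construction.

(** Without this the probability could be the quotient 0 / 0, which is 0 by convention. *)
Lemma triangulations_gt0 n g : 0 < n -> 2 * g <= n -> 0 < #|triangulations n g|.
Proof.
case: n => // n _ gn; have [r [nx [[n3 nN] [[rK rN] rJ rV]]]] := gluing_exists gn.
have cD : #|{: 'I_n.+1 * bool * 'Z_3}| = 6 * n.+1.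
  by rewrite !card_prod !card_ord card_bool /Zp_trunc /=; lia.
pose h (x : 'I_n.+1 * bool * 'Z_3) : 'I_(6 * n.+1) := cast_ord cD (enum_rank x).
pose h' (x : 'I_(6 * n.+1)) : 'I_n.+1 * bool * 'Z_3 := enum_val (cast_ord (esym cD) x).
have hK : cancel h h' by move=> x; rewrite /h /h' cast_ordK enum_rankK.
have h'K : cancel h' h by move=> x; rewrite /h /h' enum_valK cast_ordKV.
have inj (p : {perm 'I_n.+1 * bool * 'Z_3}) : injective (fun x => h (p (h' x))).
  by move=> x y /(can_inj hK) /perm_inj /(can_inj h'K).
pose m : labelled_map n.+1 := (perm (inj r), perm (inj nx), h (ord0, true, 0%R)).
have mr x : lrev m x = h (r (h' x)) by rewrite permE.
have mn x : lnext m x = h (nx (h' x)) by rewrite permE.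
suff mT : is_triangulation g m.
  apply/card_gt0P; exists [set m' in [set m | is_triangulation g m] | rooted_iso m m'].
  by apply/imsetP; exists m; rewrite ?inE.
have VE : n.+3 - 2 * g + 2 * g = n.+1 + 2 by lia.
apply/(is_triangulationP VE); split; [split=> z | split; [split=> z | | ]].
- by rewrite !mn !hK n3 h'K.
- by rewrite mn => e; case: (nN (h' z)); rewrite -[RHS](congr1 h' e) hK.
- by rewrite !mr !hK rK h'K.
- by rewrite mr => e; case: (rN (h' z)); rewrite -[RHS](congr1 h' e) hK.
- move=> S hr hn u v; have := rJ (S \o h) _ _ (h' u) (h' v); rewrite /= !h'K; apply.
  + by move=> z /=; rewrite -(hr (h z)) mr hK.
  + by move=> z /=; rewrite -(hn (h z)) mn hK.
- rewrite -rV; apply: (card_porbits_conj (h := h)); first by exists h'.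
  by move=> x; rewrite !permM mr mn !hK.
Qed.

(** * Asymptotics *)

From mathcomp Require Import all_classical all_reals all_analysis.
From mathcomp Require Import ring lra.
Import Order.TTheory GRing.Theory Num.Theory.
Import numFieldNormedType.Exports.

Local Open Scope classical_set_scope.
Local Open Scope ring_scope.

(** The factors are bounded by [8 * 2 ^ k] and [16 * 2 ^ k]. *)
Lemma ladder_growth_bound (q k : nat) :
  (q ^ k * ((6 * k + 2) * (16 * k)) <= 128 * (4 * q) ^ k)%N.
Proof.
have h : (k <= 2 ^ k)%N by apply/ltnW/ltn_expl.
have -> : (128 * (4 * q) ^ k = q ^ k * (8 * 2 ^ k * (16 * 2 ^ k)))%N.
  by rewrite expnMn (_ : 4 = 2 * 2)%N // expnMn; lia.
rewrite leq_mul2l; apply/orP; right; apply: leq_mul; last by rewrite leq_mul2l h orbT.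
have : (0 < 2 ^ k)%N by rewrite expn_gt0.
lia.
Qed.

(** The 2 in the rate keeps the growth below the square root of [n], so that dividing by [n] still
    gives a bound tending to 0. *)
Lemma expn_truncn_le (R : realType) (K n l : nat) : (1 < K)%N -> (0 < n)%N ->
  l = Num.truncn (1 / (2 * ln (K%:R : R)) * ln (n%:R : R)) ->
  (K ^ l.-1 * K ^ l.-1 <= n)%N.
Proof.
move=> K1 n0 ->; set x := _ * _; set k := _.-1.
have lnK0 : 0 < ln (K%:R : R) by rewrite ln_gt0 // ltr1n.
have lnn : 0 <= ln (n%:R : R) by rewrite ln_ge0 // ler1n.
have x0 : 0 <= x by rewrite mulr_ge0 // divr_ge0 // mulr_ge0 // ltW.
have kx : (k%:R : R) <= x.
  apply: le_trans (_ : (Num.truncn x)%:R <= x); last by rewrite truncn_le.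
  by rewrite ler_nat leq_pred.
have eK : (K%:R : R) = expR (ln K%:R) by rewrite lnK // posrE ltr0n ltnW.
have en : (n%:R : R) = expR (ln n%:R) by rewrite lnK // posrE ltr0n.
rewrite -expnD -(ler_nat R) natrX eK -expRM_natl en ler_expR natrD.
have -> : ln (n%:R : R) = x * (2 * ln K%:R) by rewrite /x; field; rewrite lt0r_neq0.
by nra.
Qed.

(* The factor 4 absorbs the polynomial factor in [card_ladder_free]. *)
Definition growth_rate (M : nat) := (4 * (72 * M * (12 * M).+1))%N.

Definition ladder_rate (R : realType) (M : nat) : R := 1 / (2 * ln (growth_rate M)%:R).

(** The margin [(1 / 2 - theta) / 2] on g/n leaves at least [(1 / 2 - theta) * n] vertices, whence
    [n <= M * V]. *)
Lemma triangulation_prob_bound (R : realType) (theta : R) (M n g : nat) :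
  theta < 1 / 2 -> (1 / 2 - theta)^-1 <= M%:R -> (0 < n)%N -> ((576 * M) ^ 2 <= n)%N ->
  g%:R / n%:R <= theta + (1 / 2 - theta) / 2 ->
  `|1 - triangulation_prob R g (@has_maximal_tentacle_with_ladder
     (Num.truncn (ladder_rate R M * ln (n%:R : R))) n)| * n%:R
  <= 22 * Num.sqrt (n%:R : R).
Proof.
move=> theta_lt hM n0 nM hg; set l := Num.truncn _; set P := @has_maximal_tentacle_with_ladder l n.
set q := (72 * M * (12 * M).+1)%N.
have nR0 : 0 < n%:R :> R by rewrite ltr0n.
have d0 : 0 < 1 / 2 - theta by lra.
have M1R : 1 <= M%:R * (1 / 2 - theta).
  by rewrite -ler_pdivrMr // [leLHS]mul1r.
have M0 : (0 < M)%N by rewrite -(ltr0n R); apply: lt_le_trans hM; rewrite invr_gt0.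
have hg' : g%:R * 2 + n%:R * (1 / 2 - theta) <= n%:R :> R.
  by move: hg; rewrite ler_pdivrMr // => ?; nra.
have gn : (2 * g <= n)%N.
  rewrite -(ler_nat R) natrM; have : 0 <= n%:R * (1 / 2 - theta) by rewrite mulr_ge0 // ltW.
  by lra.
set V := (n + 2 - 2 * g)%N.
have VE : (V + 2 * g = n + 2)%N by rewrite /V; lia.
have V2 : (1 < V)%N by rewrite /V; lia.
have nMV : (n <= M * V)%N.
  rewrite -(ler_nat R) natrM.
  have VR : V%:R = n%:R + 2 - 2 * g%:R :> R.
    by rewrite -[2 * g%:R]natrM -[_ + 2]natrD -VE natrD addrK.
  have MV : M%:R * (n%:R * (1 / 2 - theta)) <= M%:R * V%:R :> R.
    by rewrite ler_pM2l ?ltr0n // VR; lra.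
  have : n%:R * 1 <= n%:R * (M%:R * (1 / 2 - theta)) :> R by rewrite ler_pM2l.
  by lra.
set u := (growth_rate M ^ l.-1)%N.
have uu : (u * u <= n)%N.
  by apply: (@expn_truncn_le R) => //; rewrite /growth_rate; nia.
have ku : (6 * l.-1 + 2 <= 8 * u)%N.
  have h1 : (l.-1 <= u)%N by apply/ltnW/ltn_expl; rewrite /growth_rate; nia.
  have h2 : (0 < u)%N by rewrite expn_gt0 /growth_rate; nia.
  by lia.
have nl : (72 * M * (6 * l.-1 + 2) <= n)%N.
  (* Here 576 = 72 * 8, and both [576 * M] and [u] are at most the square root of [n]. *)
  apply: (@leq_trans (576 * M * u)); first by nia.
  rewrite -(@leq_exp2r _ _ 2) // expnMn; apply: leq_trans (leq_mul nM uu) _.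
  by rewrite mulnn.
have bad := card_bad_classes VE V2 n0 nMV nl.
have T0 := triangulations_gt0 n0 gn.
rewrite -/q in bad.
have bad2 := leq_trans bad (leq_mul (ladder_growth_bound q l.-1) (leqnn _)).
have gsub : (#|good_classes n g l| <= #|triangulations n g|)%N.
  by apply/subset_leq_card/fintype.subsetP => c; rewrite inE => /andP[].
rewrite -/(growth_rate M) -/u in bad2.
have -> : triangulation_prob R g P = #|good_classes n g l|%:R / #|triangulations n g|%:R by [].
set G := #|good_classes n g l| in bad2 gsub *; set C := #|triangulations n g| in bad2 gsub T0 *.
have C0 : 0 < C%:R :> R by rewrite ltr0n.
have -> : 1 - G%:R / C%:R = (C - G)%:R / C%:R :> R.
  by rewrite natrB // mulrBl divff // lt0r_neq0.
rewrite ger0_norm ?divr_ge0 // mulrAC ler_pdivrMr //.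
have usq : u%:R <= Num.sqrt (n%:R : R).
  rewrite -[leLHS]ger0_norm // -sqrtr_sqr ler_wsqrtr //.
  by rewrite -natrX ler_nat -mulnn.
move: bad2; rewrite -(ler_nat R) !natrM => bad2.
have : u%:R * C%:R <= Num.sqrt n%:R * C%:R :> R by rewrite ler_pM2r.
have : 0 <= Num.sqrt n%:R * C%:R :> R by rewrite mulr_ge0 ?sqrtr_ge0 ?ltW.
(* The constant 22 exceeds 128 / 6. *)
by nra.
Qed.

Theorem lemma14 (R : realType) (theta : R) (theta_gt0 : 0 < theta)
    (theta_lt : theta < 1 / 2) :
  exists2 s : R, 0 < s &
    forall g : nat -> nat,
      (fun n : nat => (g n)%:R / n%:R : R) @ \oo --> theta ->
      (fun n : nat => triangulation_prob R (g n)
         (@has_maximal_tentacle_with_ladder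
            (Num.truncn (s * ln (n%:R : R))) n)) @ \oo --> (1 : R).
Proof.
have d0 : 0 < 1 / 2 - theta by lra.
set M := (Num.truncn (1 / 2 - theta)^-1).+1.
have hM : (1 / 2 - theta)^-1 <= M%:R.
  apply/ltW; have /truncn_itv/andP[_] : 0 <= (1 / 2 - theta)^-1 by rewrite invr_ge0 ltW.
  by [].
have q1 : (1 < growth_rate M)%N by rewrite /growth_rate; lia.
exists (ladder_rate R M).
  by rewrite /ladder_rate divr_gt0 // mulr_gt0 // ln_gt0 // ltr1n.
move=> g hg; apply/cvgrPdist_le => eps eps0.
have hd : 0 < (1 / 2 - theta) / 2 by lra.
move/cvgrPdist_le : hg => /(_ _ hd) hg.
near=> n.
have n0 : (0 < n)%N by near: n; apply: nbhs_infty_ge.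
have nR0 : 0 < n%:R :> R by rewrite ltr0n.
have nM : ((576 * M) ^ 2 <= n)%N by near: n; apply: nbhs_infty_ge.
(* Equivalent to [22 * sqrt n <= eps * n]. *)
have ne : (22 / eps) ^+ 2 <= n%:R by near: n; apply: nbhs_infty_ger.
have hgn : `|theta - (g n)%:R / n%:R| <= (1 / 2 - theta) / 2 by near: n.
have hgn2 : (g n)%:R / n%:R <= theta + (1 / 2 - theta) / 2.
  by move: hgn; rewrite ler_distlC => /andP[_].
have := triangulation_prob_bound theta_lt hM n0 nM hgn2.
move=> h; rewrite -(ler_pM2r nR0); apply: le_trans h _.
rewrite -[X in eps * X](sqr_sqrtr (ltW nR0)) expr2 mulrA ler_pM2r ?sqrtr_gt0 //.
rewrite mulrC -ler_pdivrMr // -[leLHS]ger0_norm; last by rewrite divr_ge0 // ltW.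
by rewrite -sqrtr_sqr ler_wsqrtr.
Unshelve. all: by end_near.
Qed.
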